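(* Let $f$ be an even continuous non-negative function on $\mathbb{R}^n$ and let $\mu$ be the measure on $\mathbb{R}^n$ with density $f$. Let $K$ and $L$ be origin-symmetric star bodies in $\mathbb{R}^n$, and let $1\le k<n$ be an integer. Suppose that $K$ and $L$ are generalized $k$-intersection bodies. Then $$|\mu(K)-\mu(L)|\le \frac{n}{n-k}\,c_{n,k}\,\max_{H}\left|\mu(K\cap H)-\mu(L\cap H)\right|\,\max\left\{\mathrm{Vol}_n(K)^{k/n},\mathrm{Vol}_n(L)^{k/n}\right\},$$ where the maximum is taken over all $(n-k)$-dimensional linear subspaces $H$ of $\mathbb{R}^n$ and $c_{n,k}=|B_2^n|^{(n-k)/n}/|B_2^{n-k}|$.
   Context: $|B_2^m|$ denotes the volume of the Euclidean unit ball in $\mathbb{R}^m$, and $\mathrm{Vol}_n$ is $n$-dimensional Lebesgue measure. $S^{n-1}$ is the Euclidean unit sphere in $\mathbb{R}^n$. For a closed bounded set $B\subset\mathbb{R}^n$, $\mu(B)=\int_B f(x)\,dx$; for an $(n-k)$-dimensional subspace $H$, $\mu(B\cap H)=\int_{B\cap H}f(x)\,dx$, where the integral is with respect to $(n-k)$-dimensional Lebesgue measure on $H$. A closed bounded set $K\subset\mathbb{R}^n$ is a star body if every straight line through the origin crosses the boundary of $K$ at exactly two points different from the origin, the origin is an interior point of $K$, and the Minkowski functional $\|x\|_K=\min\{a\ge 0: x\in aK\}$ is a continuous function on $\mathbb{R}^n$. It is origin-symmetric if $K=-K$. $G(n,n-k)$ is the Grassmannian of $(n-k)$-dimensional linear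 subspaces of $\mathbb{R}^n$. The $(n-k)$-dimensional spherical Radon transform $\mathcal{R}_{n-k}:C(S^{n-1})\to C(G(n,n-k))$ is defined by $\mathcal{R}_{n-k}(g)(H)=\int_{S^{n-1}\cap H} g(x)\,dx$, where integration is with respect to the (unnormalized) surface measure on the unit sphere $S^{n-1}\cap H$ of $H$ (counting measure if $n-k=1$). Let $X=\mathcal{R}_{n-k}(C(S^{n-1}))\subset C(G(n,n-k))$, and let $M^+(X)$ be the set of linear continuous (in the sup norm) functionals $\nu$ on $X$ that are positive, i.e. $\nu(h)\ge 0$ for every non-negative $h\in X$. An origin-symmetric star body $K$ in $\mathbb{R}^n$ is a generalized $k$-intersection body if there exists $\nu\in M^+(X)$ such that for every $g\in C(S^{n-1})$, $$\int_{S^{n-1}}\|x\|_K^{-k}g(x)\,dx=\nu(\mathcal{R}_{n-k}(g)),$$ where $dx$ is the unnormalized surface measure on $S^{n-1}$. *)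

(* Defs.v *)
From HB Require Import structures.
From mathcomp Require Import all_boot all_order all_algebra.
From mathcomp Require Import all_classical all_reals all_analysis.
From mathcomp Require Import measurable_realfun.

Set Implicit Arguments.
Unset Strict Implicit.
Unset Printing Implicit Defensive.

Import Order.TTheory GRing.Theory Num.Theory.
Import numFieldNormedType.Exports.

Local Open Scope classical_set_scope.
Local Open Scope ring_scope.

(* R^n is 'rV[R]_n with its library topology, and with the sigma-algebra      *)
(* generated by the coordinates, i.e. the Borel sigma-algebra.                *)

Section rV_measurable.
Context (R : realType) (n : nat).

Definition rV_coord (i : 'I_n) (x : 'rV[R]_n) : R := x ord0 i.

Let rV_set0 : g_sigma_preimage rV_coord set0.
Proof. exact: sigma_algebra0. Qed.

Let rV_setC A : g_sigma_preimage rV_coord A -> g_sigma_preimage rV_coord (~` A).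
Proof. exact: sigma_algebraC. Qed.

Let rV_bigcup (F : _^nat) : (forall i, g_sigma_preimage rV_coord (F i)) ->
  g_sigma_preimage rV_coord (\bigcup_i (F i)).
Proof. exact: sigma_algebra_bigcup. Qed.

HB.instance Definition _ :=
  @isMeasurable.Build (measure_tuple_display default_measure_display)
    'rV[R]_n (g_sigma_preimage rV_coord) rV_set0 rV_setC rV_bigcup.

End rV_measurable.

Lemma measurable_rV_coord (R : realType) n (i : 'I_n) :
  measurable_fun [set: 'rV[R]_n] (@rV_coord R n i).
Proof.
move=> _ Y mY; rewrite setTI; apply: sub_sigma_algebra => /=.
rewrite -bigcup_seq/=; exists i => /=; first by rewrite mem_index_enum.
by exists Y => //; rewrite setTI.
Qed.

Lemma measurable_fun_rVP (R : realType) n d (T : measurableType d)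
    (f : T -> 'rV[R]_n) :
  (forall i, measurable_fun [set: T] (fun x => f x ord0 i)) ->
  measurable_fun [set: T] f.
Proof.
move=> mf; apply: (@measurability _ _ _ _ setT f
  (\big[setU/set0]_(i < n) preimage_set_system setT (@rV_coord R n i) measurable)).
  by [].
move=> _ [B + <-]; rewrite -bigcup_seq => -[i _ [C mC <-]].
by rewrite setTI; exact: (mf i measurableT C mC).
Qed.

Section lebesgue_measure_rV.
Context (R : realType).

Definition rV_cons n (p : measurableTypeR R * 'rV[R]_n) : 'rV[R]_n.+1 :=
  row_mx (const_mx p.1 : 'rV[R]_1) p.2.

Lemma rV_cons0 n (p : measurableTypeR R * 'rV[R]_n) :
  rV_cons p ord0 ord0 = p.1.
Proof.
rewrite /rV_cons (_ : ord0 = lshift n (ord0 : 'I_1)); last exact: val_inj.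
by rewrite (row_mxEl (const_mx p.1 : 'rV[R]_1) p.2) mxE.
Qed.

Lemma rV_consS n (p : measurableTypeR R * 'rV[R]_n) j :
  rV_cons p ord0 (lift ord0 j) = p.2 ord0 j.
Proof.
rewrite /rV_cons (_ : lift ord0 j = rshift 1 j); last exact: val_inj.
by rewrite (row_mxEr (const_mx p.1 : 'rV[R]_1) p.2).
Qed.

Definition rV_uncons n (x : 'rV[R]_n.+1) : measurableTypeR R * 'rV[R]_n :=
  (x ord0 ord0, \row_j x ord0 (lift ord0 j)).

Lemma rV_consK n : cancel (@rV_cons n) (@rV_uncons n).
Proof.
move=> [a y]; rewrite /rV_uncons rV_cons0; congr pair.
by apply/rowP => j; rewrite mxE rV_consS.
Qed.

Lemma measurable_rV_cons n : measurable_fun setT (@rV_cons n).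
Proof.
apply: measurable_fun_rVP => i; have [j ->|->] := unliftP ord0 i.
  rewrite (_ : (fun _ => _) = @rV_coord R n j \o snd).
    by apply: measurableT_comp => //; exact: measurable_rV_coord.
  by apply/funext => p; rewrite rV_consS.
by rewrite (_ : (fun _ => _) = fst) //; apply/funext => p; rewrite rV_cons0.
Qed.

Lemma measurable_rV_uncons n : measurable_fun setT (@rV_uncons n).
Proof.
apply/measurable_fun_pairP; split; first exact: (@measurable_rV_coord R n.+1 ord0).
apply: measurable_fun_rVP => i.
rewrite (_ : (fun _ => _) = @rV_coord R n.+1 (lift ord0 i)).
  exact: measurable_rV_coord.
by apply/funext => x /=; rewrite mxE.
Qed.

Section step.
Context n (m : {sigma_finite_measure set 'rV[R]_n -> \bar R}).

Definition rV_lebesgueS : set 'rV[R]_n.+1 -> \bar R :=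
  pushforward (lebesgue_measure \x m)%E (@rV_cons n).

Let rV_lebesgueS0 : rV_lebesgueS set0 = 0%E.
Proof. by rewrite /rV_lebesgueS /pushforward preimage_set0 measure0. Qed.

Let rV_lebesgueS_ge0 A : (0 <= rV_lebesgueS A)%E.
Proof. exact: (measure_ge0 (lebesgue_measure \x m)%E). Qed.

Let rV_lebesgueS_sigma_additive : semi_sigma_additive rV_lebesgueS.
Proof.
apply: (@measure_semi_sigma_additive _ _ _
  (pushforward (lebesgue_measure \x m)%E (@rV_cons n) : {measure set _ -> \bar R})).
exact: measurable_rV_cons.
Qed.

HB.instance Definition _ := isMeasure.Build _ _ _ rV_lebesgueS
  rV_lebesgueS0 rV_lebesgueS_ge0 rV_lebesgueS_sigma_additive.

Let rV_lebesgueS_sigma_finite : sigma_finite setT rV_lebesgueS.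
Proof.
have /sigma_finiteP[F [TF ndF Foo]] := sigma_finiteT (@lebesgue_measure R).
have /sigma_finiteP[G [TG ndG Goo]] := sigma_finiteT m.
exists (fun k => @rV_uncons n @^-1` (F k `*` G k)).
  rewrite -preimage_bigcup (_ : \bigcup_k _ = setT) ?preimage_setT//.
  apply/seteqP; split => // -[x y] _.
  have [k _ Fkx] : (\bigcup_k F k) x by rewrite -TF.
  have [l _ Gly] : (\bigcup_k G k) y by rewrite -TG.
  exists (maxn k l) => //; split => /=.
    by move: Fkx; exact/subsetPset/ndF/leq_maxl.
  by move: Gly; exact/subsetPset/ndG/leq_maxr.
move=> k; have [? ?] := Foo k; have [? ?] := Goo k.
have mFG : measurable (F k `*` G k) by exact: measurableX.
split; first by rewrite -[X in measurable X]setTI; exact: measurable_rV_uncons.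
rewrite /rV_lebesgueS /pushforward (_ : _ @^-1` _ = F k `*` G k).
  by rewrite product_measure1E// lte_mul_pinfty// ge0_fin_numE.
by apply/funext => p; rewrite /preimage /mkset rV_consK.
Qed.

HB.instance Definition _ := Measure_isSigmaFinite.Build _ _ _ rV_lebesgueS
  rV_lebesgueS_sigma_finite.

End step.

Fixpoint rV_lebesgue n : {sigma_finite_measure set 'rV[R]_n -> \bar R} :=
  if n is n'.+1 then rV_lebesgueS (rV_lebesgue n') else dirac (0 : 'rV[R]_0).

End lebesgue_measure_rV.

Lemma rV_lebesgue_box (R : realType) n (A : 'I_n -> set R) :
  (forall i, measurable (A i)) ->
  rV_lebesgue R n [set x | forall i, A i (x ord0 i)] =
  (\prod_(i < n) lebesgue_measure (A i))%E.
Proof.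
elim: n A => [|n IHn] A mA.
  rewrite big_ord0 /= diracE mem_set//= => -[] //.
rewrite big_ord_recl.
transitivity ((lebesgue_measure \x rV_lebesgue R n)%E
    (A ord0 `*` [set y : 'rV[R]_n | forall i, A (lift ord0 i) (y ord0 i)])).
  congr ((lebesgue_measure \x rV_lebesgue R n)%E _).
  apply/seteqP; split => -[a y] /=.
    by move=> Ax; split=> [|i]; [have := Ax ord0|have := Ax (lift ord0 i)];
      rewrite ?rV_cons0 ?rV_consS.
  by move=> [A0 AS] i; have [j ->|->] := unliftP ord0 i;
    rewrite ?rV_cons0 ?rV_consS.
rewrite product_measure1E; first by congr (_ * _)%E; exact: IHn.
  exact: mA.
rewrite (_ : [set y | _] =
    \bigcap_(i in [set: 'I_n]) (@rV_coord R n i @^-1` A (lift ord0 i))).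
  apply: fin_bigcap_measurable => // i _.
  rewrite -[X in measurable X]setTI; by apply: measurable_rV_coord => //; exact: mA.
by apply/seteqP; split => y /= Ay i; [move=> _; exact: Ay|exact: Ay].
Qed.

Section euclidean.
Context (R : realType) (n : nat).

Definition enorm (x : 'rV[R]_n) : R := Num.sqrt (\sum_i x ord0 i ^+ 2).

Definition eball : set 'rV[R]_n := [set x | enorm x <= 1].

Definition esphere : set 'rV[R]_n := [set x | enorm x = 1].

Definition radial (x : 'rV[R]_n) : 'rV[R]_n := (enorm x)^-1 *: x.

Lemma measurable_enorm : measurable_fun [set: 'rV[R]_n] enorm.
Proof.
apply: (measurableT_comp (continuous_measurable_fun (@sqrt_continuous R))).
apply: measurable_sum => i; apply: measurable_funX.
exact: measurable_rV_coord.
Qed.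

Lemma measurable_radial : measurable_fun [set: 'rV[R]_n] radial.
Proof.
apply: measurable_fun_rVP => i.
rewrite (_ : (fun _ => _) = fun x => enorm x `^ (-1) * rV_coord i x); last first.
  by apply/funext => x; rewrite mxE powR_inv1// sqrtr_ge0.
apply: measurable_funM; last exact: measurable_rV_coord.
apply: (measurableT_comp (measurable_powR _)); exact: measurable_enorm.
Qed.

Lemma measurable_punctured_eball : measurable [set x : 'rV[R]_n | 0 < enorm x <= 1].
Proof.
rewrite (_ : [set _ | _] = enorm @^-1` `]0, 1]).
  by rewrite -[X in measurable X]setTI; exact: measurable_enorm.
by apply/seteqP; split => x /=; rewrite in_itv.
Qed.

(* Surface measure, on the unit sphere, of an m-dimensional space whose       *)
(* Lebesgue measure is lam: the mass of A is m times the volume of the cone   *)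
(* {r u : 0 < r <= 1, u in A}. For m = 1 this is the counting measure.        *)
Definition surface_measure (m : nat) (lam : {measure set 'rV[R]_n -> \bar R}) :
    set 'rV[R]_n -> \bar R :=
  fun A => (m%:R%:E *
    lam ([set x | A (radial x)] `&` [set x | (0 < enorm x <= 1)%R]))%E.

Section surface_measure.
Context (m : nat) (lam : {measure set 'rV[R]_n -> \bar R}).

Let surface_measure0 : surface_measure m lam set0 = 0%E.
Proof.
by rewrite /surface_measure (_ : [set x | set0 (radial x)] = set0) ?set0I
  ?measure0 ?mule0//; exact/seteqP.
Qed.

Let surface_measure_ge0 A : (0 <= surface_measure m lam A)%E.
Proof. by apply: mule_ge0; rewrite ?lee_fin. Qed.

Let surface_measure_sigma_additive : semi_sigma_additive (surface_measure m lam).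
Proof.
pose mu1 : {measure set 'rV[R]_n -> \bar R} :=
  mrestr lam measurable_punctured_eball.
have mu2_additive : semi_sigma_additive (pushforward mu1 radial).
  apply: (@measure_semi_sigma_additive _ _ _
    (pushforward mu1 radial : {measure set _ -> \bar R})).
  exact: measurable_radial.
move=> F mF tF mUF.
rewrite (_ : (fun k => _) = (fun k => m%:R%:E *
    \sum_(0 <= i < k) pushforward mu1 radial (F i))%E).
  by apply: cvgeZl => //; exact: mu2_additive.
apply/funext => k; rewrite ge0_sume_distrr// => i _.
exact: (measure_ge0 mu1).
Qed.

HB.instance Definition _ := isMeasure.Build _ _ _ (surface_measure m lam)
  surface_measure0 surface_measure_ge0 surface_measure_sigma_additive.

End surface_measure.

End euclidean.

Arguments eball {R n}.
Arguments esphere {R n}.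

Definition grassmannian (R : realType) (n m : nat) : Type :=
  {H : {vspace 'rV[R]_n} | \dim H == m}.
HB.instance Definition _ (R : realType) (n m : nat) :=
  Choice.on (grassmannian R n m).

Section subspace.
Context (R : realType) (n m : nat).
Implicit Type H : grassmannian R n m.

Definition carrier H : set 'rV[R]_n := [set x | x \in val H].

Definition orthonormal_basis H : set 'M[R]_(m, n) :=
  [set U | U *m U^T = 1%:M /\ range (fun y : 'rV[R]_m => y *m U) = carrier H].

(* Lebesgue measure on H is transported from R^m by an isometry R^m -> H;     *)
(* the choice of the orthonormal basis of H is immaterial.                    *)
Definition isometry_to H (y : 'rV[R]_m) : 'rV[R]_n :=
  y *m xget 0 (orthonormal_basis H).

Lemma measurable_isometry_to H : measurable_fun setT (isometry_to H).
Proof.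
apply: measurable_fun_rVP => j; rewrite /isometry_to; set U := xget _ _.
rewrite (_ : (fun _ => _) = fun y => \sum_i rV_coord i y * U i j).
  apply: measurable_sum => i; apply: measurable_funM => //.
  exact: measurable_rV_coord.
by apply/funext => y; rewrite mxE.
Qed.

Definition lebesgue_on H : set 'rV[R]_n -> \bar R :=
  pushforward (rV_lebesgue R m) (isometry_to H).

Section lebesgue_on.
Context H.

Let lebesgue_on0 : lebesgue_on H set0 = 0%E.
Proof. by rewrite /lebesgue_on /pushforward preimage_set0 measure0. Qed.

Let lebesgue_on_ge0 A : (0 <= lebesgue_on H A)%E.
Proof. exact: (measure_ge0 (rV_lebesgue R m)). Qed.

Let lebesgue_on_sigma_additive : semi_sigma_additive (lebesgue_on H).
Proof.
apply: (@measure_semi_sigma_additive _ _ _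
  (pushforward (rV_lebesgue R m) (isometry_to H) : {measure set _ -> \bar R})).
exact: measurable_isometry_to.
Qed.

HB.instance Definition _ := isMeasure.Build _ _ _ (lebesgue_on H)
  lebesgue_on0 lebesgue_on_ge0 lebesgue_on_sigma_additive.

End lebesgue_on.

Definition radon (g : 'rV[R]_n -> R) : grassmannian R n m -> R :=
  fun H => \int[surface_measure m (lebesgue_on H)]_(x in esphere `&` carrier H) g x.

Definition sphere_continuous (g : 'rV[R]_n -> R) : Prop :=
  {within esphere, continuous g}.

(* {uniform _ -> R} carries the topology of the sup norm. *)
Definition radon_range : set {uniform grassmannian R n m -> R} :=
  [set h | exists2 g, sphere_continuous g & h = radon g].

Definition positive_functional (nu : {uniform grassmannian R n m -> R} -> R) : Prop :=
  [/\ forall (a : R) (h1 h2 : grassmannian R n m -> R),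
        radon_range h1 -> radon_range h2 ->
        nu (fun H => a * h1 H + h2 H) = a * nu h1 + nu h2,
      {within radon_range, continuous nu} &
      forall h : grassmannian R n m -> R,
        radon_range h -> (forall H, 0 <= h H) -> 0 <= nu h].

End subspace.

Section bodies.
Context (R : realType) (n : nat).
Implicit Type K : set 'rV[R]_n.

Definition boundary K : set 'rV[R]_n := closure K `\` interior K.

Definition line (u : 'rV[R]_n) : set 'rV[R]_n := [set x | exists t : R, x = t *: u].

(* On star bodies the infimum is a minimum. *)
Definition minkowski_functional K (x : 'rV[R]_n) : R :=
  inf [set a | 0 <= a /\ exists2 y, K y & x = a *: y].

Definition star_body K : Prop :=
  [/\ closed K, bounded_set K,
      forall u, u != 0 -> exists p q, p != q /\
        (boundary K `&` line u) `\ 0 = [set p; q],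
      interior K 0 &
      continuous (minkowski_functional K)].

Definition origin_symmetric K : Prop := [set - x | x in K] = K.

Definition generalized_intersection_body (k : nat) K : Prop :=
  [/\ star_body K, origin_symmetric K &
    exists2 nu : {uniform grassmannian R n (n - k) -> R} -> R,
      positive_functional nu &
      forall g, sphere_continuous g ->
        \int[surface_measure n (rV_lebesgue R n)]_(x in esphere)
          ((minkowski_functional K x) ^- k * g x) =
        nu (radon g)].

Definition vol K : R := fine (rV_lebesgue R n K).

Definition density_measure (f : 'rV[R]_n -> R) K : R :=
  \int[rV_lebesgue R n]_(x in K) f x.

Definition density_section (f : 'rV[R]_n -> R) K m (H : grassmannian R n m) : R :=
  \int[lebesgue_on H]_(x in K `&` carrier H) f x.

End bodies.

(* Main.v *)
Require Import Defs.
From mathcomp Require Import all_boot all_order all_algebra.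
From mathcomp Require Import all_classical all_reals all_analysis.
From mathcomp Require Import measurable_realfun lra ring.

(** The inequality compares the two measures through the functional nu that makes
    K a generalized k-intersection body.

    Let m = n - k, let N be the Minkowski functional of K, S the unit sphere of
    R^n, B its unit ball and sigma the surface measure, and for a star body A let
    F_A (x) be the integral of r^(m-1) 1_A (r x) f (r x) over r > 0. In polar
    coordinates the measure of the section of A by H is the integral of F_A over
    the unit sphere of H, that is, the Radon transform of F_A at H
    (density_section_moment).

    Let eps be an upper bound of mu (K /\ H) - mu (L /\ H) over all H, and let s
    be the area of the unit sphere in dimension m. Then g = eps / s - F_K + F_L is
    continuous on S and its Radon transform is nonnegative. Positivity of nu and
    the identity that defines nu give int_S N^-k g >= 0, that is,

      int_S N^-k (F_K - F_L) <= eps / s * int_S N^-k.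

    On the left, N (r x)^-k = r^-k N (x)^-k and polar coordinates in R^n show that
    int_S N^-k F_A is the integral of f N^-k over A. Since K is the set N <= 1,
    replacing the weight N^-k by 1 decreases the difference of these integrals for
    A = K and A = L; the left-hand side is thus at least mu (K) - mu (L)
    (weighted_comparison). On the right, int_S N^-n = n vol K, and Young's
    inequality gives int_S N^-k <= n (vol K)^(k/n) (vol B)^(m/n)
    (sphere_integral_gauge_power_le). As s = m vol (B^m), these are the constants
    of the theorem, and exchanging K and L gives the absolute value.

    Three ingredients have to be prepared. Polar coordinates follow from Tonelli
    and the behaviour of Lebesgue measure under dilations, because the surface
    measure is defined by cones (polar_coordinates_rV), and they carry over to a
    subspace by a linear isometry. That K is the set N <= 1 follows from the
    hypothesis that a line meets the boundary in only two points
    (minkowski_le1P). Finally F_A is continuous on S by dominated convergence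
    (continuous_ray_integral). *)

Set Implicit Arguments.
Unset Strict Implicit.
Unset Printing Implicit Defensive.

Import Order.TTheory GRing.Theory Num.Theory.
Import numFieldNormedType.Exports.

Local Open Scope classical_set_scope.
Local Open Scope ring_scope.

(** * Borel sets of R^n *)

Section borel.
Context (R : realType).

Lemma measurable_rV_box n (A : 'I_n -> set R) : (forall i, measurable (A i)) ->
  measurable [set x : 'rV[R]_n | forall i, A i (x ord0 i)].
Proof.
move=> mA; rewrite (_ : [set x | _] =
    \bigcap_(i in [set: 'I_n]) (@rV_coord R n i @^-1` A i)).
  apply: fin_bigcap_measurable => // i _.
  by rewrite -[X in measurable X]setTI; apply: measurable_rV_coord => //; exact: mA.
by apply/seteqP; split => y /= Ay i; [move=> _; exact: Ay|exact: Ay].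
Qed.

(** Every point of an open set lies in a box inside the set with rational centre
    and radius of the form 1/(j+1), and there are countably many such boxes. *)
Lemma open_measurable_rV n (U : set 'rV[R]_n) : open U -> measurable U.
Proof.
move=> oU.
pose box (q : 'rV[rat]_n * nat) := [set x : 'rV[R]_n | forall i,
  `](ratr (q.1 ord0 i) - q.2.+1%:R^-1 : R), (ratr (q.1 ord0 i) + q.2.+1%:R^-1 : R)[%classic
     (x ord0 i)].
have -> : U = \bigcup_q (if `[< box q `<=` U >] then box q else set0).
  apply/seteqP; split => [x Ux|x [q _]]; last first.
    by case: ifPn => [/asboolP qU /qU|].
  have /nbhs_ballP[e /= e0 xeU] : nbhs x U by exact: open_nbhs_nbhs.
  have [k ke] : exists k : nat, k.+1%:R^-1 < e / 2.
    have e20 : 0 < e / 2 by rewrite divr_gt0.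
    exists (Num.trunc (e / 2)^-1).
    by rewrite -[ltRHS]invrK ltf_pV2 ?posrE ?invr_gt0//; apply: truncnS_gt.
  suff [q qx qe] : exists2 q, box (q, k) x & box (q, k) `<=` ball x e.
    by exists (q, k) => //; rewrite ifT//; apply/asboolP => y /qe; exact: xeU.
  have k0 : (0 : R) < k.+1%:R^-1 by rewrite invr_gt0.
  move: ke k0; rewrite /box/=; move: (k.+1%:R^-1) => d de d0.
  have /choice[q qx] : forall i : 'I_n, exists q : rat,
      x ord0 i - d < ratr q < x ord0 i + d.
    move=> i; have [|q] := @rat_in_itvoo R (x ord0 i - d) (x ord0 i + d).
      by lra.
    by rewrite in_itv/=; exists q.
  exists (\row_i q i).
    by move=> i /=; rewrite mxE in_itv/=; have /andP[q1 q2] := qx i; apply/andP; split; lra.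
  move=> y /= yb; split => // i j; rewrite ord1.
  have /andP[q1 q2] := qx j; have := yb j; rewrite /= mxE in_itv/= => /andP[y1 y2].
  by rewrite /ball/= ltr_norml; apply/andP; split; lra.
apply: countable_bigcupT_measurable; [exact: countableP|move=> q; case: ifPn => // _].
apply: (@measurable_rV_box n (fun i =>
  `](ratr (q.1 ord0 i) - q.2.+1%:R^-1 : R), (ratr (q.1 ord0 i) + q.2.+1%:R^-1 : R)[%classic)).
by move=> i; exact: measurable_itv.
Qed.

Lemma continuous_measurable_rV n (f : 'rV[R]_n -> R) :
  continuous f -> measurable_fun setT f.
Proof.
move=> /continuousP cf; apply: (measurability _ (RGenOpens.measurableE R)) => //.
move=> _ [_ [a [b ->] <-]]; rewrite setTI; apply: open_measurable_rV.
by apply: cf; exact: interval_open.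
Qed.

Lemma closed_measurable_rV n (A : set 'rV[R]_n) : closed A -> measurable A.
Proof. by rewrite -openC => /open_measurable_rV; rewrite -{2}(setCK A); exact: measurableC. Qed.

Lemma measurable_scale_pair n :
  measurable_fun setT (fun p : measurableTypeR R * 'rV[R]_n => p.1 *: p.2).
Proof.
apply: measurable_fun_rVP => i.
rewrite (_ : (fun _ => _) = (fun p : measurableTypeR R * 'rV[R]_n => p.1 * rV_coord i p.2)).
  apply: measurable_funM => //.
  by apply: measurableT_comp => //; exact: measurable_rV_coord.
by apply/funext => p; rewrite mxE.
Qed.

Lemma measurable_scale n (c : R) : measurable_fun setT (fun x : 'rV[R]_n => c *: x).
Proof.
apply: measurable_fun_rVP => i.
rewrite (_ : (fun _ => _) = (fun x : 'rV[R]_n => c * rV_coord i x)).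
  by apply: measurable_funM => //; exact: measurable_rV_coord.
by apply/funext => p; rewrite mxE.
Qed.

End borel.

(** * Dilations of Lebesgue measure *)

Section scaling.
Context (R : realType).
Local Open Scope ereal_scope.

(** Uniqueness of Lebesgue measure: after multiplication by c, the image of
    Lebesgue measure under r |-> c r still gives every interval its length. *)
Lemma lebesgue_measure_dilation (c : R) (A : set (measurableTypeR R)) :
  (0 < c)%R -> measurable A ->
  lebesgue_measure ((fun r : measurableTypeR R => (c * r)%R : measurableTypeR R) @^-1` A) =
  (c^-1)%:E * lebesgue_measure A.
Proof.
move=> c0 mA.
have mc : measurable_fun setT (fun r : measurableTypeR R => (c * r)%R : measurableTypeR R).
  exact: (mulrl_measurable c).
have c0' : (0 <= c)%R by exact: ltW.
pose mu : {measure set (measurableTypeR R) -> \bar R} :=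
  mscale (NngNum c0') (pushforward lebesgue_measure
    (fun r : measurableTypeR R => (c * r)%R : measurableTypeR R) :
    {measure set (measurableTypeR R) -> \bar R}).
rewrite (@lebesgue_measure_unique R (mu mc) _ A mA).
  by rewrite /mu /= /mscale/= muleA -EFinM mulVf ?gt_eqF// mul1e.
move=> _ [[a b] _ <-]; rewrite /mu /= /mscale/= /pushforward.
rewrite (_ : _ @^-1` _ = `](c^-1 * a)%R, (c^-1 * b)%R]%classic).
  rewrite !lebesgue_measure_itv/= !lte_fin ltr_pM2l ?invr_gt0//.
  by case: ifPn; rewrite ?mule0// -!EFinD -EFinM -mulrBr mulVKf ?gt_eqF.
apply/seteqP; split => x /=; rewrite !in_itv/= !(mulrC c^-1%R).
  by rewrite ltr_pdivrMr// ler_pdivlMr// !(mulrC x).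
by rewrite ltr_pdivrMr// ler_pdivlMr// !(mulrC x).
Qed.

Lemma integral_dilation (c : R) (q : measurableTypeR R -> \bar R) : (0 < c)%R ->
  measurable_fun setT q -> (forall r, 0 <= q r) ->
  \int[lebesgue_measure]_r q (c * r)%R = (c^-1)%:E * \int[lebesgue_measure]_r q r.
Proof.
move=> c0 mq q0.
have mc : measurable_fun setT (fun r : measurableTypeR R => (c * r)%R : measurableTypeR R).
  exact: (mulrl_measurable c).
have c0' : (0 <= c^-1)%R by rewrite invr_ge0 ltW.
rewrite -(@ge0_integral_mscale _ _ _ lebesgue_measure _ measurableT (NngNum c0'))//.
transitivity (\int[pushforward lebesgue_measure
    (fun r : measurableTypeR R => (c * r)%R : measurableTypeR R)]_r q r).
  by rewrite ge0_integral_pushforward.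
apply: eq_measure_integral => A mA _.
exact: lebesgue_measure_dilation.
Qed.

Lemma integral_rV_lebesgueS n (h : 'rV[R]_n.+1 -> \bar R) :
  measurable_fun setT h -> (forall x, 0 <= h x) ->
  \int[rV_lebesgue R n.+1]_x h x =
  \int[lebesgue_measure]_a \int[rV_lebesgue R n]_y h (rV_cons (a, y)).
Proof.
move=> mh h0.
have mhc : measurable_fun setT (h \o @rV_cons R n).
  exact: (measurableT_comp mh (@measurable_rV_cons R n)).
have := @fubini_tonelli1 _ _ _ _ R lebesgue_measure (rV_lebesgue R n)
  (h \o @rV_cons R n) mhc (fun=> h0 _).
rewrite /fubini_F/= => <-.
have := @ge0_integral_pushforward _ _ _ _ R _ (@measurable_rV_cons R n)
  (lebesgue_measure \x rV_lebesgue R n) setT h measurableT mh (fun x _ => h0 x).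
rewrite preimage_setT => <-.
by apply: eq_measure_integral; first exact: measurable_rV_cons.
Qed.

(** The measure is built one coordinate at a time, so Tonelli extracts one
    factor 1/c for each coordinate. *)
Lemma integral_rV_dilation n (c : R) (h : 'rV[R]_n -> \bar R) : (0 < c)%R ->
  measurable_fun setT h -> (forall x, 0 <= h x) ->
  \int[rV_lebesgue R n]_x h (c *: x) =
  (c ^- n)%:E * \int[rV_lebesgue R n]_x h x.
Proof.
move=> c0; elim: n h => [|n IHn] h mh h0.
  by rewrite expr0 invr1 mul1e; apply: eq_integral => x _; congr h; apply/rowP => -[].
rewrite !integral_rV_lebesgueS//; last first.
  exact: (measurableT_comp mh (measurable_scale _)).
have mhc : measurable_fun setT (h \o @rV_cons R n).
  exact: (measurableT_comp mh (@measurable_rV_cons R n)).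
have scons a y : c *: rV_cons (a, y) = rV_cons ((c * a)%R : measurableTypeR R, c *: y) :> 'rV[R]_n.+1.
  apply/rowP => i; rewrite mxE; have [j ->|->] := unliftP ord0 i.
    by rewrite !rV_consS mxE.
  by rewrite !rV_cons0.
transitivity (\int[lebesgue_measure]_a
    ((c ^- n)%:E * \int[rV_lebesgue R n]_y h (rV_cons ((c * a)%R : measurableTypeR R, y)))).
  apply: eq_integral => a _; under eq_integral do rewrite scons.
  apply: (IHn (fun y => h (rV_cons ((c * a)%R : measurableTypeR R, y)))) => //.
  exact: (measurableT_comp mhc (measurable_pair1 _)).
have mI : measurable_fun [set: measurableTypeR R]
    (fun a => \int[rV_lebesgue R n]_y h (rV_cons (a, y))).
  by apply: (measurable_fun_fubini_tonelli_F (h \o @rV_cons R n)) => //= p.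
have I0 a : 0 <= \int[rV_lebesgue R n]_y h (rV_cons (a, y)) by exact: integral_ge0.
pose I a := \int[rV_lebesgue R n]_y h (rV_cons (a, y)).
have mIc : measurable_fun [set: measurableTypeR R] (fun a => I (c * a)%R).
  by apply: (measurableT_comp mI); exact: (mulrl_measurable c).
have cn0 : (0 <= c ^- n)%R by rewrite invr_ge0 exprn_ge0// ltW.
have -> := @ge0_integralZl_EFin _ _ _ lebesgue_measure setT measurableT
  (fun a => I (c * a)%R) (fun a _ => I0 (c * a)%R) mIc _ cn0.
rewrite (integral_dilation c0 mI)// muleA -EFinM; congr (_%:E * _).
by rewrite exprSr invfM.
Qed.

Lemma rV_lebesgue_set1 n : (0 < n)%N -> rV_lebesgue R n [set (0%R : 'rV[R]_n)] = 0.
Proof.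
move=> n0; have -> : [set (0%R : 'rV[R]_n)] = [set x : 'rV[R]_n | forall i, [set (0 : R)%R] (x ord0 i)].
  apply/seteqP; split => [x /= -> i|x /= x0]; first by rewrite mxE.
  by apply/rowP => i; rewrite x0 mxE.
rewrite (@rV_lebesgue_box R n (fun=> [set 0%R])) => [|i]; last exact: measurable_set1.
case: n n0 => // n _; rewrite big_ord_recl lebesgue_measure_set1 mul0e//.
Qed.

End scaling.

(** * Polar coordinates in R^n *)

Section tail.
Context (R : realType).

(** On each half-line the inverse is, up to sign, a power function with real
    exponent, so that its discontinuity at 0 does no harm. *)
Lemma measurable_invr : measurable_fun setT (@GRing.inv R).
Proof.
rewrite (_ : GRing.inv = fun x : R => if 0 <= x then x `^ (-1) else - ((- x) `^ (-1))).
  apply: measurable_fun_ifT.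
  - exact: measurable_fun_ler.
  - exact: measurable_powR.
  - apply: measurableT_comp => //.
    exact: (measurableT_comp (measurable_powR (-1))).
apply/funext => x; case: ifPn => [x0|]; first by rewrite powR_inv1.
by rewrite -ltNge => x0; rewrite powR_inv1 ?invrN ?opprK// oppr_ge0 ltW.
Qed.

(** The radial integral to which polar coordinates reduce below; an antiderivative
    of the integrand is - 1 / (m r^m). *)
Lemma integral_inv_power_tail (m : nat) (a : R) : (0 < m)%N -> 0 < a ->
  (\int[lebesgue_measure]_(r in `[a, +oo[) (r ^- m.+1)%:E = (a ^- m / m%:R)%:E)%E.
Proof.
move=> m0 a0.
have m0' : (m%:R : R) != 0 by rewrite pnatr_eq0 -lt0n.
pose F (x : R) : R := - m%:R^-1 * (x ^- m).
pose f (x : R) : R := x ^- m.+1.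
have cX p (x : R) : 0 < x -> {for x, continuous (fun x : R => x ^- p)}.
  move=> x0; apply: continuous_comp; first exact: exprn_continuous.
  by apply: inv_continuous; rewrite expf_neq0// gt_eqF.
have dF (x : R) : 0 < x -> is_derive x 1 F (f x).
  move=> x0; have xm : x ^+ m != 0 by rewrite expf_neq0// gt_eqF.
  have h1 := @is_deriveX R R id m x 1 1 (is_derive_id x 1).
  have {}h1 : is_derive x (1 : R) (fun y : R => y ^+ m) ((m%:R * x ^+ m.-1) *: (1 : R)).
    by move: h1; rewrite exprfctE.
  have h2 := is_deriveZ (- m%:R^-1 : R) (@is_deriveV R (fun y : R => y ^+ m) x _ 1 xm h1).
  apply: (is_derive_eq h2).
  rewrite /f /GRing.scale/= (exprS x m).
  have xE : x ^+ m = x * x ^+ m.-1 by rewrite -exprS prednK.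
  have : x ^+ m.-1 != 0 by rewrite expf_neq0// gt_eqF.
  rewrite xE; move: (x ^+ m.-1) (m%:R : R) m0' => u M M0 u0.
  by field; rewrite M0 u0 gt_eqF.
rewrite (@ge0_continuous_FTC2y R f F a 0).
- by rewrite -EFinB sub0r /F mulNr opprK mulrC.
- by move=> x ax; rewrite /f invr_ge0 exprn_ge0// (le_trans _ ax)// ltW.
- apply: continuous_in_subspaceT => x; rewrite inE/= in_itv/= andbT => ax.
  by apply: cX; exact: lt_le_trans ax.
- rewrite -(mulr0 (- m%:R^-1 : R)); apply: cvgMr => /=.
  have -> : (fun x : R => x ^- m) = (fun x => x^-1 ^+ m) by apply/funext => x; rewrite exprVn.
  rewrite [X in _ --> X](_ : 0 = 0 ^+ m); last by rewrite expr0n gtn_eqF.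
  apply: (@cvg_comp _ _ _ GRing.inv (fun x : R => x ^+ m)); last exact: exprn_continuous.
  apply/gtr0_cvgV0 => //; near=> x; near: x; exact: nbhs_pinfty_gt.
- by move=> x ax; have [] := dF _ (lt_trans a0 ax).
- apply: cvg_at_right_filter; apply: cvgMr; exact: cX.
- move=> x; rewrite in_itv/= andbT => ax.
  by rewrite derive1E; have [_] := dF _ (lt_trans a0 ax).
Unshelve. all: by end_near. Qed.

End tail.

Section enorm.
Context (R : realType).

Lemma enorm_ge0 n (x : 'rV[R]_n) : 0 <= enorm x.
Proof. exact: sqrtr_ge0. Qed.

Lemma enormZ n (c : R) (x : 'rV[R]_n) : enorm (c *: x) = `|c| * enorm x.
Proof.
rewrite /enorm; under eq_bigr do rewrite mxE exprMn.
by rewrite -mulr_sumr sqrtrM ?sqr_ge0// sqrtr_sqr.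
Qed.

Lemma enorm_eq0 n (x : 'rV[R]_n) : (enorm x == 0) = (x == 0).
Proof.
apply/idP/eqP => [|->]; last first.
  by rewrite /enorm big1 ?sqrtr0// => i _; rewrite mxE expr0n.
rewrite /enorm sqrtr_eq0 => x0; apply/rowP => i; rewrite mxE; apply/eqP.
rewrite -sqrf_eq0 eq_le sqr_ge0 andbT; apply: le_trans x0.
by rewrite (bigD1 i)//= lerDl sumr_ge0// => j _; exact: sqr_ge0.
Qed.

Lemma enorm_gt0 n (x : 'rV[R]_n) : (0 < enorm x) = (x != 0).
Proof. by rewrite lt_def enorm_ge0 andbT enorm_eq0. Qed.

Lemma measurable_rV_set1 n : measurable [set (0 : 'rV[R]_n)].
Proof.
rewrite (_ : [set _] = @enorm R n @^-1` [set 0%R]).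
  by rewrite -[X in measurable X]setTI; exact: (measurable_enorm measurableT (measurable_set1 _)).
by apply/seteqP; split => x /= => [->|/eqP]; [apply/eqP; rewrite enorm_eq0|rewrite enorm_eq0 => /eqP].
Qed.

End enorm.

Section polar.
Context (R : realType).
Local Open Scope ereal_scope.

(** The weight r^(m-1) is the Jacobian of polar coordinates in dimension m. The
    exponent is independent of the ambient dimension n, so that the definition
    also serves for m-dimensional subspaces of R^n. *)
Definition ray_integral m n (h : 'rV[R]_n -> \bar R) (x : 'rV[R]_n) : \bar R :=
  \int[lebesgue_measure]_(r in `]0%R, +oo[) ((r ^+ m.-1)%:E * h (r *: x)).

Lemma ray_integralE m n (h : 'rV[R]_n -> \bar R) x :
  ray_integral m h x = \int[lebesgue_measure]_r
    (if (0 < r)%R then (r ^+ m.-1)%:E * h (r *: x) else 0).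
Proof.
rewrite /ray_integral integral_mkcond; apply: eq_integral => r _.
by rewrite patchE mem_setE in_itv/= andbT.
Qed.

Lemma measurable_pos_fst n :
  measurable_fun setT (fun x : measurableTypeR R * 'rV[R]_n => (0 < x.1)%R).
Proof. by apply: measurable_fun_ltr => //; exact: measurable_fst. Qed.

Lemma measurable_enorm_snd n :
  measurable_fun setT (fun x : measurableTypeR R * 'rV[R]_n => enorm x.2).
Proof. by apply: measurableT_comp => //; exact: measurable_enorm. Qed.

Lemma measurable_ray_integrand m n (h : 'rV[R]_n -> \bar R) : measurable_fun setT h ->
  measurable_fun setT (fun p : measurableTypeR R * 'rV[R]_n =>
    if (0 < p.1)%R then (p.1 ^+ m.-1)%:E * h (p.1 *: p.2) else 0).
Proof.
move=> mh; apply: measurable_fun_ifT => //; first exact: measurable_pos_fst.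
apply: emeasurable_funM.
  apply/measurable_EFinP; apply: measurable_funX; exact: measurable_fst.
exact: (measurableT_comp mh (@measurable_scale_pair R n)).
Qed.

Lemma ray_integrand_ge0 m n (h : 'rV[R]_n -> \bar R) : (forall x, 0 <= h x) ->
  forall (r : R) x, 0 <= if (0 < r)%R then (r ^+ m.-1)%:E * h (r *: x) else 0.
Proof.
move=> h0 r x; case: ifPn => // r0.
by rewrite mule_ge0// lee_fin exprn_ge0// ltW.
Qed.

Lemma ray_integral_ge0 m n (h : 'rV[R]_n -> \bar R) x : (forall x, 0 <= h x) ->
  0 <= ray_integral m h x.
Proof.
move=> h0; rewrite ray_integralE; apply: integral_ge0 => r _.
exact: ray_integrand_ge0.
Qed.

Lemma measurable_ray_integral m n (h : 'rV[R]_n -> \bar R) :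
  measurable_fun setT h -> (forall x, 0 <= h x) ->
  measurable_fun setT (ray_integral m h).
Proof.
move=> mh h0; rewrite (_ : ray_integral m h = fun x => \int[lebesgue_measure]_r
    (if (0 < r)%R then (r ^+ m.-1)%:E * h (r *: x) else 0)).
  have := @measurable_fun_fubini_tonelli_G _ _ _ _ R lebesgue_measure _
    (@measurable_ray_integrand m n h mh); apply => p.
  exact: ray_integrand_ge0.
by apply/funext => x; rewrite ray_integralE.
Qed.

(** The substitution r |-> |x| r. *)
Lemma ray_integral_radial m n (h : 'rV[R]_n -> \bar R) x : (0 < m)%N ->
  measurable_fun setT h -> (forall x, 0 <= h x) -> (0 < enorm x)%R ->
  ray_integral m h (radial x) =
  (enorm x ^+ m)%:E * ray_integral m h x.
Proof.
move=> m0 mh h0 x0; rewrite !ray_integralE.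
pose q (r : measurableTypeR R) := if (0 < r)%R then (r ^+ m.-1)%:E * h (r *: radial x) else 0.
have mq : measurable_fun setT q.
  exact: (measurableT_comp (measurable_ray_integrand m mh)
             (@measurable_pair2 _ _ _ _ (radial x))).
have q0 r : 0 <= q r by exact: ray_integrand_ge0.
transitivity ((enorm x)%:E * \int[lebesgue_measure]_r q (enorm x * r)%R).
  by rewrite (integral_dilation x0 mq q0) muleA -EFinM divff ?mul1e// gt_eqF.
have xm0 : (0 <= enorm x ^+ m.-1)%R by rewrite exprn_ge0// ltW.
rewrite -[in RHS](prednK m0) exprS EFinM -muleA; congr (_ * _).
rewrite -ge0_integralZl_EFin//; last 2 first.
- by move=> r _; exact: ray_integrand_ge0.
- exact: (measurableT_comp (measurable_ray_integrand m mh)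
             (@measurable_pair2 _ _ _ _ x)).
apply: eq_integral => r _; rewrite /q pmulr_rgt0//.
case: ifPn => r0; last by rewrite mule0.
rewrite muleA -EFinM exprMn; congr (_%:E * h _).
by rewrite /radial scalerA mulrAC divff ?gt_eqF// mul1r.
Qed.

(** The integrands shell_in and shell_out on R x R^m are what Tonelli exchanges in
    the proof of polar coordinates. Integrated over r, the first gives the ray
    integral in the direction of x and the second gives h x / m; for a fixed r
    they have the same integral over R^m. *)
Definition shell_in m (h : 'rV[R]_m -> \bar R) (p : measurableTypeR R * 'rV[R]_m) :=
  if (0 < p.1)%R && (0 < enorm p.2 <= 1)%R
  then (enorm p.2 ^+ m * p.1 ^+ m.-1)%:E * h (p.1 *: p.2) else 0.

Definition shell_out m (h : 'rV[R]_m -> \bar R) (p : measurableTypeR R * 'rV[R]_m) :=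
  if (0 < p.1)%R && (0 < enorm p.2 <= p.1)%R
  then (enorm p.2 ^+ m * p.1 ^- m.+1)%:E * h p.2 else 0.

Section shells.
Context (m : nat) (h : 'rV[R]_m -> \bar R).
Hypotheses (m0 : (0 < m)%N) (mh : measurable_fun setT h) (h0 : forall x, 0 <= h x).

Lemma shell_in_ge0 p : 0 <= shell_in h p.
Proof.
rewrite /shell_in; case: ifPn => // /andP[p0 _].
by rewrite mule_ge0// lee_fin mulr_ge0// exprn_ge0 ?enorm_ge0// ltW.
Qed.

Lemma shell_out_ge0 p : 0 <= shell_out h p.
Proof.
rewrite /shell_out; case: ifPn => // /andP[p0 _].
by rewrite mule_ge0// lee_fin mulr_ge0 ?invr_ge0// exprn_ge0 ?enorm_ge0// ltW.
Qed.

Lemma measurable_shell_in : measurable_fun setT (shell_in h).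
Proof.
have mfst : measurable_fun setT (fun p : measurableTypeR R * 'rV[R]_m => (p.1 : R)).
  exact: measurable_fst.
have men := @measurable_enorm_snd m.
apply: measurable_fun_ifT => //.
- apply: measurable_and; first exact: measurable_pos_fst.
  by apply: measurable_and; [exact: measurable_fun_ltr|exact: measurable_fun_ler].
- apply: emeasurable_funM.
    by apply/measurable_EFinP; apply: measurable_funM; exact: measurable_funX.
  exact: (measurableT_comp mh (@measurable_scale_pair R m)).
Qed.

Lemma measurable_shell_out : measurable_fun setT (shell_out h).
Proof.
have mfst : measurable_fun setT (fun p : measurableTypeR R * 'rV[R]_m => (p.1 : R)).
  exact: measurable_fst.
have men := @measurable_enorm_snd m.
apply: measurable_fun_ifT => //.
- apply: measurable_and; first exact: measurable_pos_fst.
  by apply: measurable_and; [exact: measurable_fun_ltr|exact: measurable_fun_ler].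
- apply: emeasurable_funM; last exact: (measurableT_comp mh measurable_snd).
  apply/measurable_EFinP; apply: measurable_funM; first exact: measurable_funX.
  apply: (measurableT_comp (@measurable_invr R)); exact: measurable_funX.
Qed.

Lemma integral_shell_in_radius x :
  \int[lebesgue_measure]_r shell_in h (r, x) =
  if (0 < enorm x <= 1)%R then ray_integral m h (radial x) else 0.
Proof.
case: ifPn => [xB|/negbTE xB]; last first.
  by rewrite integral0_eq// => r _; rewrite /shell_in/= xB andbF.
have /andP[x0 _] := xB; rewrite ray_integral_radial// ray_integralE.
rewrite -ge0_integralZl_EFin//; last 3 first.
- by move=> r _; exact: ray_integrand_ge0.
- exact: (measurableT_comp (measurable_ray_integrand m mh)
             (@measurable_pair2 _ _ _ _ x)).
- by rewrite exprn_ge0// ltW.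
apply: eq_integral => r _; rewrite /shell_in/= xB andbT.
by case: ifPn; rewrite ?mule0// muleA EFinM.
Qed.

(** The dilation x |-> r x carries the unit ball to the ball of radius r and
    contributes the factor r^m. *)
Lemma integral_shell_in_out r :
  \int[rV_lebesgue R m]_x shell_in h (r, x) =
  \int[rV_lebesgue R m]_x shell_out h (r, x).
Proof.
have [r0|r0] := ltP 0%R r; last first.
  by rewrite !integral0_eq// => x _; rewrite /shell_out/shell_in/= ltNge r0.
have -> : (fun x => shell_in h (r, x)) =
    (fun x => (r ^+ m)%:E * shell_out h (r, r *: x)).
  apply/funext => x; rewrite /shell_in /shell_out/= r0/= enormZ gtr0_norm//.
  rewrite pmulr_rgt0// ger_pMr//; case: ifPn => xB; last by rewrite mule0.
  rewrite muleA -EFinM; congr (_%:E * _).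
  have rE : (r ^+ m = r * r ^+ m.-1)%R by rewrite -exprS prednK.
  have : (r ^+ m.-1)%R != 0%R by rewrite expf_neq0// gt_eqF.
  rewrite exprMn (exprS r m) !rE; move: (r ^+ m.-1)%R (enorm x ^+ m)%R => u v u0.
  by field; rewrite u0 gt_eqF.
have rm0 : (0 <= r ^+ m)%R by rewrite exprn_ge0// ltW.
have mo : measurable_fun setT (fun x : 'rV[R]_m => shell_out h (r, x)).
  exact: (measurableT_comp measurable_shell_out (measurable_pair1 _)).
have mor : measurable_fun setT (fun x : 'rV[R]_m => shell_out h (r, r *: x)).
  exact: (measurableT_comp mo (measurable_scale r)).
rewrite ge0_integralZl_EFin//; last by move=> x _; exact: shell_out_ge0.
rewrite (integral_rV_dilation r0 mo); last by move=> x; exact: shell_out_ge0.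
by rewrite muleA -EFinM divff ?mul1e// expf_neq0// gt_eqF.
Qed.

(** For a fixed x the constraint is r >= |x|, and the tail integral
    |x|^-m / m cancels the weight |x|^m. *)
Lemma integral_shell_out x : x != 0%R ->
  \int[lebesgue_measure]_r shell_out h (r, x) = (m%:R^-1)%:E * h x.
Proof.
rewrite -enorm_gt0 => x0.
have m0' : (m%:R : R) != 0%R by rewrite pnatr_eq0 -lt0n.
transitivity ((enorm x ^+ m)%:E * h x * \int[lebesgue_measure]_(r in `[enorm x, +oo[) (r ^- m.+1)%:E).
  rewrite -ge0_integralZl//; last 3 first.
  - apply/measurable_EFinP/measurable_funTS; apply: (measurableT_comp (@measurable_invr R)).
    exact: measurable_funX.
  - move=> r; rewrite /= in_itv/= andbT => xr.
    by rewrite lee_fin invr_ge0 exprn_ge0// (le_trans _ xr)// ltW.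
  - by rewrite mule_ge0// lee_fin exprn_ge0// ltW.
  rewrite [RHS]integral_mkcond; apply: eq_integral => r _.
  rewrite patchE mem_setE in_itv/= andbT /shell_out/= x0/=.
  case: ifPn => [/andP[r0 xr]|]; first by rewrite xr EFinM muleAC.
  by case: ifPn => // xr; rewrite (lt_le_trans x0 xr).
rewrite integral_inv_power_tail// muleAC -EFinM; congr (_%:E * _).
have : (enorm x ^+ m)%R != 0%R by rewrite expf_neq0// gt_eqF.
by move: (enorm x ^+ m)%R (m%:R : R) m0' => u v v0 u0; field; rewrite v0 u0.
Qed.

(** As the surface measure is defined by cones, the right-hand side involves two
    radii, one along the ray and one in the ball. The dilation by the first turns
    the second into a tail integral that can be computed. *)
Lemma polar_coordinates_rV :
  \int[rV_lebesgue R m]_x h x =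
  m%:R%:E * \int[rV_lebesgue R m]_(x in [set x | (0 < enorm x <= 1)%R])
    ray_integral m h (radial x).
Proof.
have mset0 := @measurable_rV_set1 R m.
have -> : \int[rV_lebesgue R m]_(x in [set x | (0 < enorm x <= 1)%R])
    ray_integral m h (radial x) =
    \int[rV_lebesgue R m]_x \int[lebesgue_measure]_r shell_out h (r, x).
  rewrite integral_mkcond.
  transitivity (\int[rV_lebesgue R m]_x \int[lebesgue_measure]_r shell_in h (r, x)).
    apply: eq_integral => x _; rewrite integral_shell_in_radius patchE.
    by rewrite mem_setE/=; case: ifP.
  have <- := @fubini_tonelli _ _ _ _ R lebesgue_measure (rV_lebesgue R m) _
    measurable_shell_in shell_in_ge0.
  have <- := @fubini_tonelli _ _ _ _ R lebesgue_measure (rV_lebesgue R m) _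
    measurable_shell_out shell_out_ge0.
  by apply: eq_integral => r _; exact: integral_shell_in_out.
rewrite (ge0_negligible_integral mset0)//; last exact: rV_lebesgue_set1.
rewrite [in RHS](ge0_negligible_integral mset0)//; last 3 first.
- exact: (measurable_fun_fubini_tonelli_G _ measurable_shell_out shell_out_ge0).
- by move=> x _; apply: integral_ge0 => r _; exact: shell_out_ge0.
- exact: rV_lebesgue_set1.
transitivity (m%:R%:E * \int[rV_lebesgue R m]_(x in setT `\` [set 0%R]) ((m%:R^-1)%:E * h x)).
  rewrite ge0_integralZl_EFin//; last 2 first.
  - exact: measurableD.
  - exact: measurable_funTS.
  by rewrite muleA -EFinM divff ?mul1e// pnatr_eq0 -lt0n.
congr (_ * _); apply: eq_integral => x; rewrite inE/= => -[_ /eqP x0].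
by rewrite integral_shell_out.
Qed.

End shells.
End polar.

(** * Polar coordinates on a subspace *)

Section surface.
Context (R : realType).
Local Open Scope ereal_scope.

Lemma measurable_esphere n : measurable (@esphere R n).
Proof.
rewrite (_ : esphere = @enorm R n @^-1` [set 1%R])//.
by rewrite -[X in measurable X]setTI; exact: (measurable_enorm measurableT (measurable_set1 _)).
Qed.

Lemma esphere_radial n (x : 'rV[R]_n) : (0 < enorm x)%R -> esphere (radial x).
Proof.
move=> x0; rewrite /esphere/= /radial enormZ gtr0_norm ?invr_gt0//.
by rewrite mulVf// gt_eqF.
Qed.

(** Up to the factor m, the surface measure is the image under radial of the
    restriction of lam to the punctured unit ball. *)
Lemma integral_surface_measure n m (lam : {measure set 'rV[R]_n -> \bar R})
    (g : 'rV[R]_n -> \bar R) :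
  measurable_fun setT g -> (forall x, 0 <= g x) ->
  \int[surface_measure m lam]_x g x =
  m%:R%:E * \int[lam]_(x in [set x | (0 < enorm x <= 1)%R]) g (radial x).
Proof.
move=> mg g0.
pose mB := @measurable_punctured_eball R n.
pose mu1 : {measure set 'rV[R]_n -> \bar R} := mrestr lam mB.
pose mu2 : {measure set 'rV[R]_n -> \bar R} := pushforward mu1 (@radial R n).
have mrad := @measurable_radial R n.
have mm : (0 <= m%:R :> R)%R by [].
transitivity (\int[mscale (NngNum mm) (mu2 mrad)]_x g x).
  by apply: eq_measure_integral.
rewrite ge0_integral_mscale//; congr (_ * _).
rewrite (@ge0_integral_pushforward _ _ _ _ R _ mrad mu1 setT g)// preimage_setT.
have mgr : measurable_fun setT (g \o @radial R n) by exact: measurableT_comp.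
rewrite (@ge0_negligible_integral _ _ R mu1 setT (~` [set x | (0 < enorm x <= 1)%R]))//; last 3 first.
- by apply: measurableC; exact: mB.
- by move=> x _; exact: g0.
- by rewrite /mu1 /= /mrestr setICl measure0.
rewrite setTD setCK; apply: eq_measure_integral => A mA AB.
by rewrite /mu1 /= /mrestr setIidl.
Qed.

End surface.

Section isometry.
Context (R : realType) (m n : nat) (U : 'M[R]_(m, n)).
Hypothesis UU : U *m U^T = 1%:M.

Lemma measurable_mulmxr : measurable_fun setT (fun y : 'rV[R]_m => y *m U).
Proof.
apply: measurable_fun_rVP => j.
rewrite (_ : (fun _ => _) = fun y => \sum_i rV_coord i y * U i j).
  apply: measurable_sum => i; apply: measurable_funM => //.
  exact: measurable_rV_coord.
by apply/funext => y; rewrite mxE.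
Qed.

Lemma enormE p (x : 'rV[R]_p) : enorm x = Num.sqrt ((x *m x^T) ord0 ord0).
Proof. by rewrite /enorm mxE; congr Num.sqrt; apply: eq_bigr => i _; rewrite mxE. Qed.

Lemma enorm_isometry (y : 'rV[R]_m) : enorm (y *m U) = enorm y.
Proof. by rewrite !enormE trmx_mul mulmxA -(mulmxA y) UU mulmx1. Qed.

Lemma radial_isometry (y : 'rV[R]_m) : radial (y *m U) = radial y *m U.
Proof. by rewrite /radial enorm_isometry scalemxAl. Qed.

Context (lam : {measure set 'rV[R]_n -> \bar R}).
Hypothesis lamE : forall A, measurable A ->
  lam A = rV_lebesgue R m ((fun y : 'rV[R]_m => y *m U) @^-1` A).
Context (D : set 'rV[R]_n).
Hypothesis mD : measurable D.
Hypothesis UD : forall y, D (y *m U).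

Local Open Scope ereal_scope.

Lemma integral_isometry (A : set 'rV[R]_n) (h : 'rV[R]_n -> \bar R) :
  measurable A -> measurable_fun setT h -> (forall x, 0 <= h x) ->
  \int[lam]_(x in A) h x =
  \int[rV_lebesgue R m]_(y in (fun y : 'rV[R]_m => y *m U) @^-1` A) h (y *m U).
Proof.
move=> mA mh h0.
have := @ge0_integral_pushforward _ _ _ _ R _ measurable_mulmxr (rV_lebesgue R m) A h mA
  (measurable_funTS mh) (fun x _ => h0 x).
move=> <-; apply: eq_measure_integral; first exact: measurable_mulmxr.
by move=> mU B mB _; rewrite lamE.
Qed.

(** The linear isometry y |-> y U commutes with dilations and with the radial
    projection, so polar coordinates are transported from R^m to its image. The
    cases of interest are U = 1 and D = R^n, and lebesgue_on H with D = carrier H. *)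
Lemma polar_coordinates_isometry (h : 'rV[R]_n -> \bar R) : (0 < m)%N ->
  measurable_fun setT h -> (forall x, 0 <= h x) ->
  \int[surface_measure m lam]_(x in esphere `&` D) ray_integral m h x =
  \int[lam]_(x in D) h x.
Proof.
move=> m0 mh h0.
have mS := @measurable_esphere R n.
have mSD : measurable (esphere `&` D) by exact: measurableI.
have mr := measurable_ray_integral m mh h0.
have r0 x := @ray_integral_ge0 R m n h x h0.
have mrS : measurable_fun setT (ray_integral m h \_ (esphere `&` D)).
  by apply/(measurable_restrictT _ mSD); exact: measurable_funTS.
have rS0 x : 0 <= (ray_integral m h \_ (esphere `&` D)) x.
  by rewrite patchE; case: ifP.
rewrite integral_mkcond integral_surface_measure//.
have mrSr := measurableT_comp mrS (@measurable_radial R n).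
rewrite (integral_isometry (@measurable_punctured_eball R n) mrSr (fun=> rS0 _)).
rewrite integral_isometry//.
have -> : (fun y : 'rV[R]_m => y *m U) @^-1` D = setT.
  by apply/seteqP; split => // y _; exact: UD.
have mhU : measurable_fun setT (fun y : 'rV[R]_m => h (y *m U)).
  exact: (measurableT_comp mh measurable_mulmxr).
rewrite (polar_coordinates_rV m0 mhU)//; congr (_ * _).
have -> : (fun y : 'rV[R]_m => y *m U) @^-1` [set x | (0 < enorm x <= 1)%R] =
    [set x | (0 < enorm x <= 1)%R].
  by apply/seteqP; split => y /=; rewrite enorm_isometry.
apply: eq_integral => y; rewrite inE/= => /andP[y0 _].
rewrite patchE ifT; last first.
  rewrite inE; split; last by rewrite radial_isometry; exact: UD.
  by apply: esphere_radial; rewrite enorm_isometry.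
rewrite radial_isometry /ray_integral; apply: eq_integral => r _.
by rewrite scalemxAl.
Qed.

(** The cone over the unit sphere is the unit ball without its centre, and points
    are null sets in positive dimension. *)
Lemma surface_measure_isometry : (0 < m)%N ->
  surface_measure m lam (esphere `&` D) = m%:R%:E * rV_lebesgue R m eball.
Proof.
move=> m0; rewrite /surface_measure; congr (_ * _).
have mS := @measurable_esphere R n.
rewrite lamE; last first.
  apply: measurableI; last exact: measurable_punctured_eball.
  rewrite -[X in measurable X]setTI; apply: measurable_radial => //.
  exact: measurableI.
rewrite (_ : _ @^-1` _ = [set x : 'rV[R]_m | (0 < enorm x <= 1)%R]); last first.
  apply/seteqP; split => y /=; first by rewrite enorm_isometry => -[].
  rewrite enorm_isometry => /[dup] /andP[y0 _] ->; split => //; split.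
    by apply: esphere_radial; rewrite enorm_isometry.
  by rewrite radial_isometry; exact: UD.
apply/eqP; rewrite eq_le; apply/andP; split.
  apply: le_measure; rewrite ?inE//.
  - exact: measurable_punctured_eball.
  - rewrite (_ : eball = @enorm R m @^-1` `]-oo, 1%R]); last first.
      by apply/seteqP; split => x /=; rewrite in_itv.
    by rewrite -[X in measurable X]setTI; exact: measurable_enorm.
  - by move=> x /= /andP[].
have -> : @eball R m = [set x | (0 < enorm x <= 1)%R] `|` [set 0%R].
  apply/seteqP; split => x /=.
    rewrite /eball/= => x1; have [->|x0] := eqVneq x 0%R; first by right.
    by left; rewrite x1 enorm_gt0 x0.
  move=> [/andP[]//|->]; rewrite /eball/=.
  by have /eqP -> : enorm (0%R : 'rV[R]_m) == 0%R by rewrite enorm_eq0.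
have mset0 : measurable [set (0%R : 'rV[R]_m)].
  exact: measurable_rV_set1.
rewrite (le_trans (measureU2 _ _ _))//; first exact: measurable_punctured_eball.
by rewrite [X in _ + X]rV_lebesgue_set1// adde0.
Qed.

End isometry.

(** * Orthonormal bases *)

Section gram_schmidt.
Context (R : realType).

Lemma sqr_enorm p (x : 'rV[R]_p) : enorm x ^+ 2 = (x *m x^T) ord0 ord0.
Proof.
rewrite enormE sqr_sqrtr// mxE sumr_ge0// => k _.
by rewrite mxE -expr2 sqr_ge0.
Qed.

(** Gram-Schmidt: the first row minus its projection to the span of the others is
    orthogonal to them, and it is nonzero because the rows are independent. *)
Lemma orthonormal_rows m n (A : 'M[R]_(m, n)) : row_free A ->
  exists2 U : 'M[R]_(m, n), U *m U^T = 1%:M & (U :=: A)%MS.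
Proof.
elim: m A => [A _|m IHm A Afree].
  by exists A => //; apply/matrixP => -[].
pose a : 'rV[R]_n := usubmx (A : 'M[R]_(1 + m, n)).
pose A' : 'M[R]_(m, n) := dsubmx (A : 'M[R]_(1 + m, n)).
have AE : (A :=: a + A')%MS.
  by apply: eqmx_sym; apply: eqmx_trans (addsmxE a A') _; rewrite vsubmxK.
have rkA : \rank A = m.+1 by apply/eqP.
have [U' U'U' U'E] : exists2 U : 'M[R]_(m, n), U *m U^T = 1%:M & (U :=: A')%MS.
  apply: IHm; rewrite -row_leq_rank -ltnS -rkA AE.
  by rewrite (leq_trans (mxrank_adds_leqif _ _).1)// -[leqRHS]add1n leq_add2r rank_leq_row.
pose w := a - a *m U'^T *m U'.
have wU' : w *m U'^T = 0 by rewrite mulmxBl -!mulmxA U'U' mulmx1 subrr.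
have w0 : w != 0.
  apply/eqP => /eqP; rewrite subr_eq0 => /eqP aE.
  have aA' : (a <= A')%MS by rewrite -U'E aE submxMl.
  have : (\rank A <= m)%N.
    rewrite AE (addsmx_idPr aA').
    exact: rank_leq_row.
  by rewrite rkA ltnn.
have c0 : 0 < enorm w by rewrite enorm_gt0.
pose u := (enorm w)^-1 *: w.
have uU' : u *m U'^T = 0 by rewrite -scalemxAl wU' scaler0.
have uu : u *m u^T = 1%:M.
  apply/matrixP => i j; rewrite !ord1 linearZ/= -scalemxAl -scalemxAr scalerA mxE.
  rewrite -sqr_enorm.
  by rewrite mxE eqxx/=; field; rewrite gt_eqF.
exists (col_mx u U' : 'M[R]_(1 + m, n)).
  rewrite (tr_col_mx u U') (mul_col_row u U' u^T U'^T) uu uU' U'U'.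
  have -> : U' *m u^T = 0 by rewrite -[LHS]trmxK trmx_mul trmxK uU' trmx0.
  by rewrite -scalar_mx_block.
apply: eqmx_trans (eqmx_sym (addsmxE u U')) _; apply: eqmx_trans (eqmx_sym AE).
apply/eqmxP/andP; split; rewrite addsmx_sub; apply/andP; split.
- apply: scalemx_sub; apply: addmx_sub; first exact: addsmxSl.
  by rewrite -mulNmx; apply: submx_trans (submxMl _ _) _; rewrite U'E addsmxSr.
- by rewrite U'E addsmxSr.
- have aE : a = enorm w *: u + a *m U'^T *m U'.
    by rewrite scalerA divff ?gt_eqF// scale1r subrK.
  rewrite [in X in (X <= _)%MS]aE; apply: addmx_sub.
    by apply: scalemx_sub; exact: addsmxSl.
  by apply: submx_trans (submxMl _ _) _; rewrite addsmxSr.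
- by rewrite -U'E addsmxSr.
Qed.

(** Hence the matrix chosen in isometry_to is an orthonormal basis of H. *)
Lemma orthonormal_basis_nonempty n m (H : grassmannian R n m) :
  orthonormal_basis H !=set0.
Proof.
case: H => V dV; rewrite /orthonormal_basis /carrier /=.
have dE := eqP dV; move: dV; subst m => _.
pose A : 'M[R]_(\dim V, n) := \matrix_(i, j) (vbasis V)`_i ord0 j.
have AE (y : 'rV[R]_(\dim V)) : y *m A = \sum_i y ord0 i *: (vbasis V)`_i.
  apply/rowP => j; rewrite mxE summxE; apply: eq_bigr => i _.
  by rewrite !mxE.
have Afree : row_free A.
  apply: inj_row_free => y; rewrite AE => y0.
  have /freeP yf : free (vbasis V) by exact: basis_free (vbasisP V).
  by apply/rowP => i; rewrite mxE; exact: (yf (fun i => y ord0 i)).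
have [U UU UA] := orthonormal_rows Afree.
exists U; split => //; apply/seteqP; split => [_ [y _ <-]|x xV] /=.
  have /submxP[z ->] : (y *m U <= A)%MS by rewrite -UA submxMl.
  rewrite AE; apply: memv_suml => i _; rewrite memvZ// vbasis_mem// mem_nth//.
  by rewrite size_tuple.
have /submxP[z ->] : (x <= U)%MS.
  rewrite UA; apply/submxP; exists (\row_i coord (vbasis V) i x).
  rewrite AE [LHS](coord_vbasis xV); apply: eq_bigr => i _.
  by rewrite mxE.
by exists z.
Qed.

End gram_schmidt.

Section subspaces.
Context (R : realType) (n m : nat) (H : grassmannian R n m).

Let U := xget 0 (orthonormal_basis H).

Lemma orthonormal_basis_xget : orthonormal_basis H U.
Proof. by apply: xgetPex; exact: orthonormal_basis_nonempty. Qed.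

(** H is the fixed space of the orthogonal projection x |-> x U^T U. *)
Lemma measurable_carrier : measurable (carrier H).
Proof.
have [UU <-] := orthonormal_basis_xget.
rewrite [X in measurable X](_ : _ = \bigcap_(i in [set: 'I_n])
  ((fun x : 'rV[R]_n => rV_coord i (x *m (U^T *m U)) - rV_coord i x) @^-1` [set 0])).
  apply: fin_bigcap_measurable => // i _.
  rewrite -[X in measurable X]setTI; apply: measurable_funB => //.
    apply: measurableT_comp; first exact: measurable_rV_coord.
    exact: measurable_mulmxr.
  exact: measurable_rV_coord.
apply/seteqP; split => [_ [y _ <-] i _|x xU].
  by rewrite /= /rV_coord mulmxA -(mulmxA y) UU mulmx1 subrr.
exists (x *m U^T) => //; apply/rowP => i; apply/eqP; rewrite -subr_eq0 -mulmxA.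
by apply/eqP; exact: (xU i).
Qed.

End subspaces.

(** * The gauge of a star body *)

Section star_body_gauge.
Context (R : realType) (n : nat) (K : set 'rV[R]_n).
Hypothesis K_star : star_body K.

Let K_closed : closed K. Proof. by case: K_star. Qed.
Let K0 : interior K 0. Proof. by case: K_star. Qed.

(** Take the supremum of the r in [a, b] with r u in K: the point lies in K because
    K is closed, but points of the ray just beyond it do not. *)
Lemma boundary_crossing (u : 'rV[R]_n) (a b : R) : a < b ->
  K (a *: u) -> ~ K (b *: u) ->
  exists2 s, a <= s < b & boundary K (s *: u).
Proof.
move=> ab Ka Kb.
pose E := [set r : R | a <= r <= b /\ K (r *: u)].
have E0 : E a by rewrite /E/= lexx ltW.
have ubE : has_ubound E by exists b => r [/andP[]].
have hsE : has_sup E by split => //; exists a.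
have aS : a <= sup E by exact: ub_le_sup.
have Sb : sup E <= b by apply: ge_sup; [exists a|move=> r [/andP[]]].
have cont_ray : continuous (fun r : R => r *: u) by move=> r; exact: scalel_continuous.
have KS : K (sup E *: u).
  apply: K_closed; rewrite closureEnbhs => A B /= KA /cont_ray/nbhs_ballP[e /= e0 eB].
  have [r Er Sr] := sup_adherent e0 hsE.
  exists (r *: u); split; first by apply: KA; case: Er.
  apply: eB; rewrite /ball/= ger0_norm ?subr_ge0 ?ub_le_sup//.
  by rewrite ltrBlDl addrC -ltrBlDl ltrBlDr -ltrBlDr.
have Sb' : sup E < b.
  by rewrite lt_neqAle Sb andbT; apply: contra_notN Kb => /eqP <-.
exists (sup E); rewrite ?aS ?Sb'//; split; first exact: subset_closure.
move=> /cont_ray/nbhs_ballP[e /= e0 eK].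
have d0 : 0 < Num.min (e / 2) (b - sup E) by rewrite lt_min divr_gt0//= subr_gt0.
have de : Num.min (e / 2) (b - sup E) < e.
  by rewrite gt_min ltr_pdivrMr// ltr_pMr// ltr1n.
have db : Num.min (e / 2) (b - sup E) <= b - sup E by rewrite ge_min lexx orbT.
move: (Num.min _ _) d0 de db => d d0 de db.
have : E (sup E + d).
  split; first by apply/andP; split; lra.
  by apply: eK; rewrite /ball/= opprD addNKr normrN gtr0_norm.
by move=> /(ub_le_sup ubE); rewrite gerDl leNgt d0.
Qed.

Lemma star_body_bounded : exists2 M : R, 0 < M & forall x, K x -> `|x| <= M.
Proof.
have [_ [M [_ KM]] _ _ _] := K_star.
exists (Num.max 1 (M + 1)); first by rewrite lt_max ltr01.
by move=> x Kx; apply: (KM _ _ x Kx); rewrite lt_max ltrDl ltr01 orbT.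
Qed.

Lemma star_body_absorbing : exists2 e : R, 0 < e & forall x, `|x| < e -> K x.
Proof.
have /nbhs_ballP[e /= e0 eK] := K0.
by exists e => // x xe; apply: eK; rewrite -ball_normE/= sub0r normrN.
Qed.

Lemma star_body_escape (u : 'rV[R]_n) (a : R) : u != 0 -> exists2 b, a < b & ~ K (b *: u).
Proof.
move=> u0; have [M M0 KM] := star_body_bounded.
have nu : 0 < `|u| by rewrite normr_gt0.
have Mu0 : 0 < M / `|u| by rewrite divr_gt0.
have na0 := normr_ge0 a; have na := ler_norm a.
exists (`|a| + M / `|u| + 1); first by lra.
have c0 : 0 < `|a| + M / `|u| + 1 by lra.
move=> /KM; rewrite normrZ gtr0_norm// -ler_pdivlMr//.
by lra.
Qed.

Lemma boundary_neq0 (u : 'rV[R]_n) : boundary K u -> u != 0.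
Proof. by move=> [_ Ku]; apply: contra_notN Ku => /eqP ->. Qed.

(** If t x were outside K, the line through x would meet the boundary between 0
    and t x, beyond x, and on the opposite ray: three nonzero points, whereas the
    definition of a star body allows two. *)
Lemma star_body_star (x : 'rV[R]_n) (t : R) : K x -> 0 <= t <= 1 -> K (t *: x).
Proof.
move=> Kx /andP[t0 t1]; apply: contrapT => Kt.
have x0 : x != 0.
  by apply/eqP => x0; apply: Kt; rewrite x0 scaler0 -x0.
have K00 (u : 'rV[R]_n) : K (0 *: u) by rewrite scale0r; exact: interior_subset K0.
have lt0t : 0 < t by rewrite lt_def t0 andbT; apply: contra_notN Kt => /eqP ->; exact: K00.
(* s1 < 1 <= s2 and - s3 <= 0 < s1 are the three parameters of boundary points. *)
have [s1 /andP[s10 s1t] bs1] := boundary_crossing lt0t (K00 x) Kt.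
have [b b1 Kb] := star_body_escape 1 x0.
have K1x : K (1 *: x) by rewrite scale1r.
have [s2 /andP[s21 _] bs2] := boundary_crossing b1 K1x Kb.
have nx0 : - x != 0 by rewrite oppr_eq0.
have [b' b'0 Kb'] := star_body_escape 0 nx0.
have [s3 /andP[s30 _] bs3] := boundary_crossing b'0 (K00 (- x)) Kb'.
have [_ _ twopoints _ _] := K_star.
have [p [q [_ pq]]] := twopoints _ x0.
have on_line s : boundary K (s *: x) -> s *: x = p \/ s *: x = q.
  move=> bs; have : [set p; q] (s *: x) by rewrite -pq; split; [split=> //; exists s|exact/eqP/boundary_neq0].
  by [].
have inj r s : r *: x = s *: x -> r = s.
  by move/eqP; rewrite -subr_eq0 -scalerBl scaler_eq0 (negbTE x0) orbF subr_eq0 => /eqP.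
have s1_neq0 : s1 != 0.
  by apply: contra_neq (boundary_neq0 bs1) => ->; rewrite scale0r.
have s1_gt0 : 0 < s1 by rewrite lt_def s1_neq0.
rewrite scalerN -scaleNr in bs3.
have [e1|e1] := on_line _ bs1; have [e2|e2] := on_line _ bs2; have [e3|e3] := on_line _ bs3;
  first [have := inj _ _ (etrans e1 (esym e2)); lra
        |have := inj _ _ (etrans e1 (esym e3)); lra
        |have := inj _ _ (etrans e2 (esym e3)); lra].
Qed.

Let S (x : 'rV[R]_n) := [set a : R | 0 <= a /\ exists2 y, K y & x = a *: y].
Let N := minkowski_functional K.

Let lbS x : has_lbound (S x). Proof. by exists 0 => a []. Qed.

Let S0 x : S x !=set0.
Proof.
have [e e0 eK] := star_body_absorbing.
have [->|x0] := eqVneq x 0.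
  by exists 0; split => //; exists 0; [exact: interior_subset K0|rewrite scaler0].
have nx : 0 < `|x| by rewrite normr_gt0.
have c0 : 0 < 2 * `|x| / e by rewrite divr_gt0// mulr_gt0.
exists (2 * `|x| / e); split; first exact: ltW.
exists ((2 * `|x| / e)^-1 *: x); last by rewrite scalerA divff ?scale1r// gt_eqF.
apply: eK; rewrite normrZ gtr0_norm ?invr_gt0// mulrC ltr_pdivrMr//.
by rewrite mulrCA divff ?gt_eqF// mulr1 mulr2n; lra.
Qed.

Lemma minkowski_ge0 x : 0 <= N x.
Proof. by apply: (lb_le_inf (S0 x)) => a []. Qed.

Let minkowski_scale_le (r : R) x : 0 < r -> N (r *: x) <= r * N x.
Proof.
move=> r0; rewrite mulrC -ler_pdivrMr//; apply: (lb_le_inf (S0 x)) => a [a0 [y Ky ->]].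
rewrite ler_pdivrMr//; apply: (ge_inf (lbS _)); split; first by rewrite mulr_ge0// ltW.
by exists y => //; rewrite scalerA mulrC.
Qed.

Lemma minkowskiZ (r : R) x : 0 < r -> N (r *: x) = r * N x.
Proof.
move=> r0; apply/eqP; rewrite eq_le minkowski_scale_le//=.
have := @minkowski_scale_le r^-1 (r *: x).
by rewrite invr_gt0 scalerA mulVf ?gt_eqF// scale1r ler_pdivlMl//; apply.
Qed.

Lemma minkowski_lower_bound : exists2 c : R, 0 < c & forall x, c * `|x| <= N x.
Proof.
have [M M0 KM] := star_body_bounded; exists M^-1; first by rewrite invr_gt0.
move=> x; apply: (lb_le_inf (S0 x)) => a [a0 [y /KM yM ->]].
by rewrite normrZ ger0_norm// mulrC ler_pdivrMr// ler_wpM2l.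
Qed.

Lemma minkowski_gt0 x : x != 0 -> 0 < N x.
Proof.
move=> x0; have [c c0 cN] := minkowski_lower_bound.
by apply: lt_le_trans (cN x); rewrite mulr_gt0// normr_gt0.
Qed.

(** If N x <= 1 then t x is in K for 0 < t < 1 because K is star-shaped, and
    x is in K because K is closed. *)
Lemma minkowski_le1P x : K x <-> N x <= 1.
Proof.
split=> [Kx|Nx1].
  by apply: (ge_inf (lbS _)); split => //; exists x => //; rewrite scale1r.
have shrink t : 0 < t < 1 -> K (t *: x).
  move=> /andP[t0 t1]; have [a [a0 [y Ky ->]] at_] : exists2 a, S x a & a < t^-1.
    by apply: (inf_lt (S0 x)); apply: le_lt_trans Nx1 _; rewrite invf_gt1.
  rewrite scalerA; apply: star_body_star => //.
  by rewrite mulr_ge0 ?(ltW t0)//= -ler_pdivlMl// mulr1 ltW.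
have cont_ray : continuous (fun r : R => r *: x) by move=> r; exact: scalel_continuous.
rewrite -(scale1r x).
apply: K_closed; rewrite closureEnbhs => A B /= KA /cont_ray/nbhs_ballP[e /= e0 eB].
have d0 : 0 < Num.min (e / 2) (1 / 2) by rewrite lt_min !divr_gt0.
have de : Num.min (e / 2) (1 / 2) < e.
  by rewrite gt_min ltr_pdivrMr// ltr_pMr// ltr1n.
have db : Num.min (e / 2) (1 / 2) <= 1 / 2 by rewrite ge_min lexx orbT.
move: (Num.min _ _) d0 de db => d d0 de db.
exists ((1 - d) *: x); split; first by apply/KA/shrink/andP; split; lra.
by apply: eB; rewrite /ball/= subKr gtr0_norm.
Qed.

Lemma continuous_minkowski : continuous N.
Proof. by case: K_star. Qed.

End star_body_gauge.

(** * Continuity of radial integrals *)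

Section sequential.
Context (R : realType) (n : nat).

(** Sequences are what dominated convergence deals with. They may be confined to
    any neighbourhood P of x, so a domination that holds only near x suffices. *)
Lemma sequential_continuity (f : 'rV[R]_n -> R) (x : 'rV[R]_n) (P : set 'rV[R]_n) :
  nbhs x P ->
  (forall u : nat -> 'rV[R]_n, (forall i, P (u i)) -> u @ \oo --> x ->
    f (u i) @[i --> \oo] --> f x) ->
  {for x, continuous f}.
Proof.
move=> xP fP; have Fx : Filter (nbhs x) by exact: nbhs_filter.
apply/(@cvgrPdist_lt _ _ _ (nbhs x)) => e e0; apply: contrapT => xnot.
have /choice[u uP] : forall i : nat, exists y,
    [/\ P y, ball x i.+1%:R^-1 y & ~ `|f x - f y| < e].
  move=> i; apply: contrapT => /forallNP iN; apply: xnot.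
  have xi : nbhs x (ball x (i.+1%:R^-1 : R)) by apply: nbhsx_ballx; rewrite invr_gt0.
  by apply: filterS (filterI xP xi) => y [Py xy]; apply: contrapT => ny; exact: (iN y).
have ux : u @ \oo --> x.
  apply/cvgrPdist_lt => d d0.
  have := near_infty_natSinv_lt (PosNum d0); apply: filterS => i /= id.
  have [_ + _] := uP i; rewrite -ball_normE/= => /lt_trans; apply.
  exact: id.
have /cvgrPdist_lt/(_ _ e0)[i _ /(_ i (leqnn i))/=] := fP u (fun i => let: And3 p _ _ := uP i in p) ux.
by have [_ _] := uP i.
Qed.

End sequential.

Section radial_function.
Context (R : realType) (n m : nat) (K : set 'rV[R]_n) (f : 'rV[R]_n -> R).
Hypotheses (K_star : star_body K) (f_cont : continuous f) (f_ge0 : forall x, 0 <= f x).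

Lemma measurable_star_body : measurable K.
Proof. by apply: closed_measurable_rV; case: K_star. Qed.

Lemma bounded_on_star_body : exists2 B : R, 0 <= B & forall x, K x -> f x <= B.
Proof.
have [Kc Kb _ _ _] := K_star.
have cK : compact K by exact: bounded_closed_compact.
have cfK : compact (f @` K).
  by apply: continuous_compact => //; apply: continuous_subspaceT.
have [M [_ fM]] := compact_bounded cfK.
exists (`|M| + 1); first by rewrite addr_ge0.
move=> x Kx; have := fM (`|M| + 1) _ (f x); rewrite /=.
move=> h; apply: le_trans (ler_norm _) _; apply: h; last by exists x.
by rewrite (le_lt_trans (ler_norm M))// ltrDl.
Qed.

Lemma measurable_patch_star_body : measurable_fun setT (fun x => ((f \_ K) x)%:E).
Proof.
apply/measurable_EFinP; apply/(measurable_restrictT _ measurable_star_body).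
by apply: measurable_funTS; exact: continuous_measurable_rV.
Qed.

Lemma patch_star_body_ge0 x : (0 <= ((f \_ K) x)%:E)%E.
Proof. by rewrite lee_fin patchE; case: ifP. Qed.

Local Notation N := (minkowski_functional K).
Let ray_density (y : 'rV[R]_n) (r : R) : R := r ^+ m.-1 * (f \_ K) (r *: y).

(** The ray through y is outside K from rho on. The condition on rho is open in y,
    hence all rays close to a given one can be integrated over the same bounded
    interval. *)
Lemma ray_integral_truncate (y : 'rV[R]_n) (rho : R) : (1 < rho * N y) ->
  0 < rho ->
  ray_integral m (fun x => ((f \_ K) x)%:E) y =
  (\int[lebesgue_measure]_(r in `]0%R, rho]) (ray_density y r)%:E)%E.
Proof.
move=> rN rho0; rewrite ray_integralE [RHS]integral_mkcond.
apply: eq_integral => r _; rewrite [RHS]patchE mem_setE in_itv/=.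
have [r0|//] := ltP 0 r; rewrite /= /ray_density.
have [//|rrho] := leP r rho.
rewrite patchE ifF ?mule0//; apply/negP; rewrite inE (minkowski_le1P K_star).
rewrite (minkowskiZ K_star)//; apply/negP; rewrite -ltNge.
apply: (lt_trans rN); rewrite ltr_pM2r//.
rewrite lt_def (minkowski_ge0 K_star) andbT; apply/eqP => N0.
by move: rN; rewrite N0 mulr0 ltr10.
Qed.

Lemma measurable_ray_density y (D : set (measurableTypeR R)) : measurable_fun D (EFin \o ray_density y).
Proof.
apply: measurable_funTS; apply/measurable_EFinP; apply: measurable_funM.
  exact: measurable_funX.
apply/measurable_EFinP.
exact: (measurableT_comp (measurableT_comp measurable_patch_star_body (@measurable_scale_pair R n))
             (@measurable_pair2 _ _ _ _ y)).
Qed.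

Lemma ray_density_bounded rho : exists2 C : R, 0 <= C & forall y r, 0 < r <= rho -> `|ray_density y r| <= C.
Proof.
have [B B0 fB] := bounded_on_star_body.
exists (`|rho| ^+ m.-1 * B); first by rewrite mulr_ge0// exprn_ge0.
move=> z r /andP[r0 rrho]; rewrite normrM ler_pM//.
  rewrite normrX lerXn2r ?nnegrE// gtr0_norm//.
  by rewrite (le_trans rrho)// ler_norm.
rewrite patchE; case: ifPn => [|_]; last by rewrite normr0.
by rewrite inE ger0_norm// => /fB.
Qed.

Lemma integrable_const_itv (C rho : R) :
  (@lebesgue_measure R).-integrable `]0%R, rho] (EFin \o cst C).
Proof.
apply: measurable_bounded_integrable => //=.
  by rewrite lebesgue_measure_itv/=; case: ifP => // _; rewrite -EFinB ltry.
exact: bounded_cst.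
Qed.

Lemma integrable_ray_density y rho : (@lebesgue_measure R).-integrable `]0%R, rho] (EFin \o ray_density y).
Proof.
have [C C0 phiC] := ray_density_bounded rho.
apply: (le_integrable _ _ _ (integrable_const_itv C rho)) => //.
  exact: measurable_ray_density.
move=> r; rewrite /= in_itv/= => r0; rewrite lee_fin (ger0_norm C0).
exact: phiC.
Qed.

(** The factor 2, instead of 1, makes the truncation valid in a neighbourhood of x. *)
Lemma truncation_radius (x : 'rV[R]_n) : x != 0 -> 1 < 2 / N x * N x /\ 0 < 2 / N x.
Proof.
move=> x0; have Nx := minkowski_gt0 K_star x0.
by rewrite divr_gt0// mulfVK ?gt_eqF// ltr1n.
Qed.

Lemma ray_integral_fin_num (x : 'rV[R]_n) : x != 0 ->
  (ray_integral m (fun x => ((f \_ K) x)%:E) x \is a fin_num)%E.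
Proof.
move=> /truncation_radius[r1 r0]; rewrite (ray_integral_truncate r1 r0).
by apply: integrable_fin_num => //; exact: integrable_ray_density.
Qed.

(** Dominated convergence: unless r = 1 / N x, the point r x is off the boundary
    of K, so that the indicator of K is constant near it. *)
Lemma continuous_ray_integral (x : 'rV[R]_n) : x != 0 ->
  {for x, continuous (fun x => fine (ray_integral m (fun x => ((f \_ K) x)%:E) x))}.
Proof.
move=> x0; have Nx := minkowski_gt0 K_star x0.
have [r1 r0] := truncation_radius x0.
have Ncont : continuous N by exact: continuous_minkowski K_star.
apply: (@sequential_continuity _ _ _ _ [set y | 1 < 2 / N x * N y]).
  have : (2 / N x * N y) @[y --> x] --> 2 / N x * N x.
    have Fx : Filter (nbhs x) by exact: nbhs_filter.
    by apply: (@cvgMr _ _ (nbhs x) Fx); exact: (Ncont x).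
  by move/(@cvgr_gt R); apply.
move=> u uP ux; rewrite (ray_integral_truncate r1 r0).
under eq_fun do rewrite (ray_integral_truncate (uP _) r0).
apply: fine_cvg; rewrite fineK; last first.
  by apply: integrable_fin_num => //; exact: integrable_ray_density.
have [C C0 phiC] := ray_density_bounded (2 / N x).
have [] := @dominated_convergence _ _ R lebesgue_measure `]0%R, 2 / N x]%classic _
  (fun i => EFin \o ray_density (u i)) (EFin \o ray_density x) (EFin \o cst C) => //.
- by move=> i; exact: measurable_ray_density.
- exact: measurable_ray_density.
(* The exceptional radius is the one at which the ray leaves K. *)
- exists [set (N x)^-1]; split => //; first exact: lebesgue_measure_set1.
  move=> r /=; apply: contra_notP => rN; rewrite in_itv/= => /andP[rpos _].
  apply: cvg_EFin; first exact: nearW.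
  apply: cvgMr.
  have rux : r *: u i @[i --> \oo] --> r *: x by exact: cvgZr.
  have Nrux : N (r *: u i) @[i --> \oo] --> N (r *: x) by exact: (cvg_comp _ _ rux (Ncont _)).
  have frux : f (r *: u i) @[i --> \oo] --> f (r *: x).
    exact: (cvg_comp _ f rux (@f_cont (r *: x))).
  have : N (r *: x) != 1.
    rewrite (minkowskiZ K_star)//; apply/eqP => rN1; apply: rN.
    by rewrite -[LHS]mulr1 -(divff (lt0r_neq0 Nx)) mulrA rN1 mul1r.
  rewrite neq_lt => /orP[lt1|gt1].
    rewrite patchE ifT; last by rewrite inE (minkowski_le1P K_star) ltW.
    apply: cvg_trans frux; apply: near_eq_cvg.
    apply: filterS (cvgr_lt _ Nrux _ lt1) => i iN.
    by rewrite patchE ifT// inE (minkowski_le1P K_star) ltW.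
  rewrite patchE ifF; last first.
    by apply/negP; rewrite inE (minkowski_le1P K_star) leNgt gt1.
  apply: cvg_near_cst.
  apply: filterS (cvgr_gt _ Nrux _ gt1) => i iN.
  rewrite patchE ifF//.
  by apply/negP; rewrite inE (minkowski_le1P K_star) leNgt iN.
- exact: integrable_const_itv.
- apply: aeW => r i; rewrite /= in_itv/= lee_fin; exact: phiC.
Unshelve. all: by end_near. Qed.

End radial_function.

(** * Volumes of balls and star bodies *)

Section volume_bounds.
Context (R : realType).

Lemma coord_le_norm n (x : 'rV[R]_n) i : `|x ord0 i| <= `|x|.
Proof.
rewrite [leRHS]/Num.norm/= mx_normrE.
by apply: (le_trans _ (le_bigmax _ _ (ord0, i))).
Qed.

Lemma coord_le_enorm n (x : 'rV[R]_n) i : `|x ord0 i| <= enorm x.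
Proof.
rewrite -sqrtr_sqr ler_wsqrtr// (bigD1 i)//= lerDl sumr_ge0// => j _.
exact: sqr_ge0.
Qed.

Lemma enorm_le_norm n (x : 'rV[R]_n) : enorm x <= Num.sqrt n%:R * `|x|.
Proof.
rewrite -[X in _ * X](ger0_norm (normr_ge0 x)) -sqrtr_sqr -sqrtrM// ler_wsqrtr//.
rewrite mulr_natl -[X in _ *+ X]card_ord -sumr_const ler_sum// => i _.
by rewrite -real_normK ?num_real// lerXn2r ?nnegrE// coord_le_norm.
Qed.

Lemma le_rV_lebesgue n (A B : set 'rV[R]_n) : measurable A -> measurable B ->
  A `<=` B -> (rV_lebesgue R n A <= rV_lebesgue R n B)%E.
Proof. by move=> mA mB AB; apply: le_measure; rewrite ?inE. Qed.

Lemma prode_const n (c : R) : (\prod_(i < n) c%:E = (c ^+ n)%:E)%E.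
Proof.
elim: n => [|n IHn]; first by rewrite big_ord0 expr0.
by rewrite big_ord_recr/= IHn -EFinM exprSr.
Qed.

Definition cube (n : nat) (E : R) : set 'rV[R]_n := [set x | forall i, `[- E, E]%classic (x ord0 i)].

Arguments cube : clear implicits.

Lemma measurable_cube n (E : R) : measurable (cube n E).
Proof. by apply: (@measurable_rV_box R n (fun=> `[- E, E]%classic)) => i; exact: measurable_itv. Qed.

Lemma rV_lebesgue_cube n (E : R) : 0 < E -> rV_lebesgue R n (cube n E) = ((2 * E) ^+ n)%:E.
Proof.
move=> E0; rewrite (@rV_lebesgue_box R n (fun=> `[- E, E]%classic)); last first.
  by move=> i; exact: measurable_itv.
rewrite -prode_const; apply: eq_bigr => i _.
rewrite lebesgue_measure_itv/= lte_fin ifT; last by lra.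
by rewrite -EFinB; congr (_%:E); lra.
Qed.

Lemma measurable_eball n : measurable (@eball R n).
Proof.
rewrite (_ : eball = @enorm R n @^-1` `]-oo, 1%R]); last first.
  by apply/seteqP; split => x /=; rewrite in_itv.
by rewrite -[X in measurable X]setTI; exact: measurable_enorm.
Qed.

Lemma eball_fin_num n : rV_lebesgue R n eball \is a fin_num.
Proof.
rewrite ge0_fin_numE//.
have sub : @eball R n `<=` cube n 1.
  move=> x /= x1 i; rewrite /= in_itv/= -ler_norml.
  exact: le_trans (coord_le_enorm _ _) x1.
have := le_rV_lebesgue (@measurable_eball n) (@measurable_cube n 1) sub.
by rewrite rV_lebesgue_cube// => /le_lt_trans; apply; rewrite ltry.
Qed.

Lemma vol_eball_gt0 n : 0 < vol (@eball R n).
Proof.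
rewrite /vol fine_gt0// -ge0_fin_numE// eball_fin_num andbT.
(* A point whose coordinates are at most E has norm at most 1, as n E^2 <= 1. *)
pose E : R := n.+1%:R^-1.
have E0 : 0 < E by rewrite invr_gt0.
have sub : cube n E `<=` @eball R n.
  move=> x /= xE; rewrite /eball/= /enorm -sqrtr1 ler_wsqrtr//.
  apply: (@le_trans _ _ (\sum_(i < n) E)).
    apply: ler_sum => i _; have := xE i; rewrite /= in_itv/= -ler_norml => xi.
    rewrite -real_normK ?num_real// expr2.
    apply: (@le_trans _ _ (1 * E)); last by rewrite mul1r.
    by rewrite ler_pM// (le_trans xi)// invf_le1// ler1n.
  by rewrite sumr_const card_ord -mulr_natl ler_pdivrMr// mul1r ler_nat.
have := le_rV_lebesgue (@measurable_cube n E) (@measurable_eball n) sub.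
by rewrite rV_lebesgue_cube//; apply: lt_le_trans; rewrite lte_fin exprn_gt0// mulr_gt0.
Qed.

Section star_body_volume.
Context (n : nat) (K : set 'rV[R]_n).
Hypothesis K_star : star_body K.

Lemma star_body_enorm_bounded : exists2 E : R, 0 < E & forall x, K x -> enorm x <= E.
Proof.
have [M M0 KM] := star_body_bounded K_star.
exists (Num.sqrt n%:R * M + 1); first by rewrite ltr_wpDl// mulr_ge0 ?sqrtr_ge0// ltW.
move=> x /KM xM; apply: le_trans (enorm_le_norm _) _.
by rewrite (@le_trans _ _ (Num.sqrt n%:R * M)) ?lerDl// ler_wpM2l ?sqrtr_ge0.
Qed.

Lemma star_body_fin_num : rV_lebesgue R n K \is a fin_num.
Proof.
have [E E0 KE] := star_body_enorm_bounded.
rewrite ge0_fin_numE//.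
have sub : K `<=` cube n E.
  move=> y /= /KE yE i; rewrite /= in_itv/= -ler_norml.
  exact: le_trans (coord_le_enorm _ _) yE.
have := le_rV_lebesgue (measurable_star_body K_star) (@measurable_cube n E) sub.
by rewrite rV_lebesgue_cube// => /le_lt_trans; apply; rewrite ltry.
Qed.

Lemma vol_star_body_gt0 : 0 < vol K.
Proof.
rewrite /vol fine_gt0// -ge0_fin_numE// star_body_fin_num andbT.
have [e e0 eK] := star_body_absorbing K_star.
have e20 : 0 < e / 2 by rewrite divr_gt0.
have sub : cube n (e / 2) `<=` K.
  move=> x /= xE; apply: eK.
  have : ball 0 e x.
    split => // i j; rewrite ord1 mxE /ball/= sub0r normrN.
    have := xE j; rewrite /= in_itv/= -ler_norml => /le_lt_trans; apply.
    by rewrite ltr_pdivrMr// ltr_pMr// ltr1n.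
  by rewrite -ball_normE/= sub0r normrN.
have := le_rV_lebesgue (@measurable_cube n (e / 2)) (measurable_star_body K_star) sub.
by rewrite rV_lebesgue_cube//; apply: lt_le_trans; rewrite lte_fin exprn_gt0// mulr_gt0.
Qed.

End star_body_volume.
End volume_bounds.

(** * Radial moments and central sections *)

Section sphere_formulas.
Context (R : realType) (n m : nat) (K : set 'rV[R]_n) (f : 'rV[R]_n -> R).
Hypotheses (K_star : star_body K) (f_cont : continuous f) (f_ge0 : forall x, 0 <= f x).
Hypothesis m0 : (0 < m)%N.

(** This is the function called F_K in the introduction. On the sphere the
    ray integral is finite and fine loses nothing. *)
Definition radial_moment (x : 'rV[R]_n) : R :=
  fine (ray_integral m (fun x => ((f \_ K) x)%:E) x).

Let mh := measurable_patch_star_body K_star f_cont.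
Let h0 := patch_star_body_ge0 K f_ge0.

Lemma measurable_radial_moment : measurable_fun setT radial_moment.
Proof. by apply: measurableT_comp => //; exact: measurable_ray_integral. Qed.

Lemma esphere_neq0 (x : 'rV[R]_n) : esphere x -> x != 0.
Proof. by rewrite /esphere/= => x1; rewrite -enorm_gt0 x1. Qed.

Lemma sphere_continuous_radial_moment : sphere_continuous radial_moment.
Proof.
apply: continuous_in_subspaceT => x; rewrite inE => /esphere_neq0.
exact: continuous_ray_integral.
Qed.

Lemma EFin_radial_moment x : esphere x ->
  (radial_moment x)%:E = ray_integral m (fun x => ((f \_ K) x)%:E) x.
Proof. by move=> /esphere_neq0 x0; rewrite fineK// ray_integral_fin_num. Qed.

Section in_subspace.
Context (H : grassmannian R n m).
Local Notation lam := (lebesgue_on H).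
Local Notation sigma := (surface_measure m (lebesgue_on H)).
Local Notation SH := (esphere `&` carrier H).
Local Notation U := (xget 0 (orthonormal_basis H)).

Let UU : U *m U^T = 1%:M. Proof. by have [] := orthonormal_basis_xget H. Qed.

Let UD y : carrier H (y *m U).
Proof. by have [_ <-] := orthonormal_basis_xget H; exists y. Qed.

Lemma measurable_subspace_sphere : measurable SH.
Proof. by apply: measurableI; [exact: measurable_esphere|exact: measurable_carrier]. Qed.

(** Polar coordinates in H. *)
Lemma integral_radial_moment :
  (\int[sigma]_(x in SH) (radial_moment x)%:E =
   \int[lam]_(x in K `&` carrier H) (f x)%:E)%E.
Proof.
transitivity (\int[sigma]_(x in SH) ray_integral m (fun x => ((f \_ K) x)%:E) x)%E.
  by apply: eq_integral => x; rewrite inE => -[xS _]; rewrite EFin_radial_moment.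
rewrite (polar_coordinates_isometry UU _ (measurable_carrier H) UD m0 mh h0)//.
rewrite setIC integral_mkcondr; apply: eq_integral => x _.
by rewrite [in RHS]patchE patchE; case: ifP.
Qed.

(** That this number is the same for all H is what makes constants
    available as test functions for the Radon transform. *)
Lemma surface_measure_subspace_sphere : sigma SH = (m%:R * vol (@eball R m))%:E.
Proof.
rewrite (surface_measure_isometry UU _ (measurable_carrier H) UD m0)//.
by rewrite EFinM /vol fineK// eball_fin_num.
Qed.

End in_subspace.
End sphere_formulas.

(** * Integration over the unit sphere *)

Section sphere.
Context (R : realType).

Lemma continuous_enorm n : continuous (@enorm R n).
Proof.
have csum (s : seq 'I_n) : continuous (fun x : 'rV[R]_n => \sum_(i <- s) x ord0 i ^+ 2).
  elim: s => [|i s IHs] x; have Fx : Filter (nbhs x) by exact: nbhs_filter.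
    by under eq_fun do rewrite big_nil; exact: (@cvg_cst _ _ _ (nbhs x) Fx).
  under eq_fun do rewrite big_cons.
  apply: (@cvgD _ _ _ (nbhs x) Fx); last exact: IHs.
  have cx : x ord0 i @[x --> x] --> x ord0 i by exact: coord_continuous.
  exact: (cvg_comp _ (fun r : R => r ^+ 2) cx (@exprn_continuous R 2 _)).
move=> x; exact: (cvg_comp _ (@Num.sqrt R) (csum _ x) (@sqrt_continuous R _)).
Qed.

Lemma norm_le_enorm n (x : 'rV[R]_n) : `|x| <= enorm x.
Proof.
rewrite [leLHS]/Num.norm/= mx_normrE; apply: bigmax_le; first exact: enorm_ge0.
by move=> [i j] _ /=; rewrite ord1 coord_le_enorm.
Qed.

Lemma compact_esphere n : compact (@esphere R n).
Proof.
apply: bounded_closed_compact.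
  exists 1; split => // M M1 x /= x1; apply: le_trans (norm_le_enorm _) _.
  by rewrite x1 ltW.
rewrite (_ : esphere = @enorm R n @^-1` [set 1])//.
by apply: preimage_closed; [move=> x _; exact: continuous_enorm|exact: closed_eq].
Qed.

Lemma sphere_continuous_bounded n (g : 'rV[R]_n -> R) : sphere_continuous g ->
  exists2 C : R, 0 <= C & forall x, esphere x -> `|g x| <= C.
Proof.
move=> cg; have cfS : compact (g @` esphere).
  by apply: continuous_compact => //; exact: compact_esphere.
have [M [_ gM]] := compact_bounded cfS.
exists (`|M| + 1); first by rewrite addr_ge0.
move=> x Sx; apply: (gM (`|M| + 1) _ (g x)); last by exists x.
by rewrite (le_lt_trans (ler_norm M))// ltrDl.
Qed.

Lemma integrable_sphere_continuous n (mu : {measure set 'rV[R]_n -> \bar R})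
    (D : set 'rV[R]_n) (g : 'rV[R]_n -> R) :
  measurable D -> (mu D < +oo)%E -> D `<=` esphere ->
  sphere_continuous g -> measurable_fun setT g -> mu.-integrable D (EFin \o g).
Proof.
move=> mD muD DS cg mg; apply: measurable_bounded_integrable => //.
  exact: measurable_funTS.
have [C C0 gC] := sphere_continuous_bounded cg.
exists C; split; first exact: num_real.
by move=> M CM x /DS/gC /le_trans; apply; exact: ltW.
Qed.

Lemma polar_coordinates_sphere n (h : 'rV[R]_n -> \bar R) : (0 < n)%N ->
  measurable_fun setT h -> (forall x, (0 <= h x)%E) ->
  (\int[surface_measure n (rV_lebesgue R n)]_(x in esphere) ray_integral n h x =
  \int[rV_lebesgue R n]_x h x)%E.
Proof.
move=> n0 mh h0; rewrite -[in LHS](setIT esphere).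
apply: (@polar_coordinates_isometry R n n 1%:M) => //; first by rewrite trmx1 mulmx1.
move=> A mA; congr (rV_lebesgue R n _).
by apply/seteqP; split => x /=; rewrite mulmx1.
Qed.

Lemma surface_measure_sphere n : (0 < n)%N ->
  surface_measure n (rV_lebesgue R n) esphere = (n%:R * vol (@eball R n))%:E.
Proof.
move=> n0; rewrite -[in LHS](setIT esphere).
rewrite (@surface_measure_isometry R n n 1%:M)//.
- by rewrite EFinM /vol fineK// eball_fin_num.
- by rewrite trmx1 mulmx1.
- move=> A mA; congr (rV_lebesgue R n _).
  by apply/seteqP; split => x /=; rewrite mulmx1.
Qed.

Lemma integral_power (n : nat) (a : R) : (0 < n)%N -> 0 < a ->
  (\int[lebesgue_measure]_(r in `]0%R, a]) (r ^+ n.-1)%:E = (a ^+ n / n%:R)%:E)%E.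
Proof.
move=> n0 a0.
have n0' : (n%:R : R) != 0 by rewrite pnatr_eq0 -lt0n.
pose F (x : R) : R := n%:R^-1 * x ^+ n.
have cF : continuous F.
  by move=> x; apply: cvgMr; exact: exprn_continuous.
have dF (x : R) : is_derive x 1 F (x ^+ n.-1).
  have h1 := @is_deriveX R R id n x 1 1 (is_derive_id x 1).
  have {}h1 : is_derive x (1 : R) (fun y : R => y ^+ n) ((n%:R * x ^+ n.-1) *: (1 : R)).
    by move: h1; rewrite exprfctE.
  have h2 := is_deriveZ (n%:R^-1 : R) h1.
  apply: (is_derive_eq h2).
  by rewrite /GRing.scale/= mulr1 mulrA mulVf// mul1r.
rewrite integral_itv_obnd_cbnd; last first.
  by apply/measurable_EFinP; exact: measurable_funX.
rewrite (@continuous_FTC2 R (fun x => x ^+ n.-1) F 0 a)//.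
- by rewrite -EFinB /F expr0n gtn_eqF// mulr0 subr0 mulrC.
- by apply: continuous_subspaceT; exact: exprn_continuous.
- split; first by move=> x _; have [] := dF x.
  + by apply: cvg_at_right_filter; exact: cF.
  + by apply: cvg_at_left_filter; exact: cF.
- by move=> x _; rewrite derive1E; have [_] := dF x.
Qed.

(** Young's inequality for t^k and 1 with the exponents n/k and n/(n-k). *)
Lemma young_exprn (t : R) (k n : nat) : (0 < k < n)%N -> 0 <= t ->
  n%:R * t ^+ k <= k%:R * t ^+ n + (n - k)%:R.
Proof.
move=> /andP[k0 kn] t0.
have k0' : 0 < k%:R :> R by rewrite ltr0n.
have n0' : 0 < n%:R :> R by rewrite ltr0n (leq_trans k0)// ltnW.
have nk0 : 0 < (n - k)%:R :> R by rewrite ltr0n subn_gt0.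
have nkE : (n - k)%:R = n%:R - k%:R :> R by rewrite natrB// ltnW.
have := @conjugate_powR R (t ^+ k) 1 (n%:R / k%:R) (n%:R / (n - k)%:R).
rewrite exprn_ge0// ler01 !divr_gt0// => /(_ erefl erefl erefl erefl).
have -> : (n%:R / k%:R)^-1 + (n%:R / (n - k)%:R)^-1 = 1 :> R.
  by rewrite !invf_div nkE; field; rewrite gt_eqF.
move=> /(_ erefl).
rewrite mulr1 powR1 -powR_mulrn// -powRrM mulrCA divff ?gt_eqF// mulr1.
rewrite !powR_mulrn// => h.
have := ler_wpM2l (ltW n0') h; rewrite mulrDr => /le_trans; apply.
rewrite le_eqVlt; apply/orP; left; apply/eqP.
rewrite !invf_div; move: (t ^+ n) (n%:R : R) (k%:R : R) ((n - k)%:R : R) n0' => u N p q N0.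
by field; rewrite gt_eqF.
Qed.

End sphere.

(** * Powers of the gauge on the sphere *)

Section weights.
Context (R : realType) (n k : nat) (K : set 'rV[R]_n).
Hypotheses (K_star : star_body K) (k0 : (0 < k)%N) (kn : (k < n)%N).

Local Notation N := (minkowski_functional K).
Local Notation sigma := (surface_measure n (rV_lebesgue R n)).
Local Notation w := (fun x => N x ^- k).

Let n0 : (0 < n)%N. Proof. exact: leq_ltn_trans kn. Qed.
Let m0 : (0 < n - k)%N. Proof. by rewrite subn_gt0. Qed.

Lemma measurable_minkowski_power j : measurable_fun setT (fun x => N x ^- j).
Proof.
apply: (measurableT_comp (@measurable_invr R)); apply: measurable_funX.
exact: continuous_measurable_rV (continuous_minkowski K_star).
Qed.

Lemma minkowski_power_ge0 j x : 0 <= N x ^- j.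
Proof. by rewrite invr_ge0 exprn_ge0// minkowski_ge0. Qed.

Lemma sphere_continuous_minkowski_power j : sphere_continuous (fun x => N x ^- j).
Proof.
apply: continuous_in_subspaceT => x; rewrite inE => /esphere_neq0 x0.
have Nx : N x ^+ j != 0 by rewrite expf_neq0// gt_eqF// minkowski_gt0.
have cN : N y @[y --> x] --> N x by exact: (continuous_minkowski K_star).
have cNj := cvg_comp _ (fun r : R => r ^+ j) cN (@exprn_continuous R j _).
exact: (cvg_comp _ (@GRing.inv R) cNj (inv_continuous Nx)).
Qed.

Lemma sphere_finite : (sigma esphere < +oo)%E.
Proof. by rewrite surface_measure_sphere// ltry. Qed.

(** By homogeneity N(r x)^-k = r^-k N(x)^-k, which lowers the radial exponent from
    n - 1 to n - k - 1. This links integrals over R^n to sections of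
    dimension n - k. *)
Lemma ray_integral_weighted (h : 'rV[R]_n -> R) x : measurable_fun setT (EFin \o h) ->
  (forall x, 0 <= h x) ->
  (ray_integral n (fun x => (h x * w x)%:E) x =
  (w x)%:E * ray_integral (n - k) (EFin \o h) x)%E.
Proof.
move=> mh h0; rewrite !ray_integralE -ge0_integralZl_EFin//; last 3 first.
- by move=> r _; apply: ray_integrand_ge0 => y; rewrite lee_fin.
- exact: (measurableT_comp (measurable_ray_integrand (n - k) mh)
             (@measurable_pair2 _ _ _ _ x)).
- exact: minkowski_power_ge0.
apply: eq_integral => r _; case: ifPn => r0; last by rewrite mule0.
rewrite /= -!EFinM; congr (_%:E); rewrite (minkowskiZ K_star)// exprMn invfM.
have -> : n.-1 = ((n - k).-1 + k)%N.
  by apply: succn_inj; rewrite -addSn (prednK m0) (prednK n0) subnK// ltnW.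
rewrite exprD; have : r ^+ k != 0 by rewrite expf_neq0// gt_eqF.
by move: (r ^+ k) (N x ^- k) (r ^+ _) (h _) => a b c d a0; field.
Qed.

Lemma integral_weighted_moment (L : set 'rV[R]_n) (f : 'rV[R]_n -> R) :
  star_body L -> continuous f -> (forall x, 0 <= f x) ->
  (\int[sigma]_(x in esphere) (w x * radial_moment (n - k) L f x)%:E =
  \int[rV_lebesgue R n]_x ((f \_ L) x * w x)%:E)%E.
Proof.
move=> L_star f_cont f_ge0.
have mh := measurable_patch_star_body L_star f_cont.
have h0 x : 0 <= (f \_ L) x by rewrite -lee_fin; exact: patch_star_body_ge0.
rewrite -polar_coordinates_sphere//; last 2 first.
- apply/measurable_EFinP/measurable_funM; last exact: measurable_minkowski_power.
  exact/measurable_EFinP.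
- by move=> x; rewrite lee_fin mulr_ge0// minkowski_power_ge0.
apply: eq_integral => x; rewrite inE => xS.
by rewrite (ray_integral_weighted _ mh h0) EFinM EFin_radial_moment.
Qed.

(** Polar coordinates for the indicator of K, whose ray integral at a unit
    vector x is N(x)^-n / n. *)
Lemma sphere_integral_gauge_volume :
  (\int[sigma]_(x in esphere) (N x ^- n)%:E)%E = (n%:R * vol K)%:E.
Proof.
have n0' : (n%:R : R) != 0 by rewrite pnatr_eq0 -lt0n.
pose one : 'rV[R]_n -> R := cst 1.
have one_cont : continuous one by move=> x; exact: cst_continuous.
have mh := measurable_patch_star_body K_star one_cont.
have h0 := @patch_star_body_ge0 R n K one (fun=> ler01).
rewrite EFinM /vol fineK ?star_body_fin_num//.
have -> : rV_lebesgue R n K = (\int[rV_lebesgue R n]_x ((one \_ K) x)%:E)%E.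
  rewrite -[LHS]mul1e -integral_cst//; last exact: measurable_star_body.
  rewrite integral_mkcond; apply: eq_integral => x _.
  by rewrite !patchE; case: ifP.
rewrite -(polar_coordinates_sphere n0 mh h0).
rewrite -ge0_integralZl_EFin//; last 3 first.
- exact: measurable_esphere.
- by move=> x _; exact: ray_integral_ge0.
- by apply: measurable_funTS; exact: measurable_ray_integral.
apply: eq_integral => x; rewrite inE => /esphere_neq0 x0.
have Nx := minkowski_gt0 K_star x0.
transitivity (n%:R%:E * \int[lebesgue_measure]_(r in `]0%R, (N x)^-1%R]) (r ^+ n.-1)%:E)%E.
  by rewrite integral_power ?invr_gt0// -EFinM mulrCA divff// mulr1 exprVn.
congr (_ * _)%E; rewrite ray_integralE integral_mkcond; apply: eq_integral => r _.
rewrite patchE mem_setE in_itv/=; case: ifPn => [/andP[r0 rN]|rN].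
  rewrite r0 patchE ifT ?mule1// inE (minkowski_le1P K_star) (minkowskiZ K_star)//.
  by rewrite -ler_pdivlMr// mul1r.
case: ifPn => // r0; rewrite patchE ifF ?mule0//; apply/negP.
rewrite inE (minkowski_le1P K_star) (minkowskiZ K_star)// -ler_pdivlMr// mul1r.
by move=> rN'; move: rN; rewrite r0 rN'.
Qed.

Lemma integrable_minkowski_power j :
  sigma.-integrable esphere (EFin \o (fun x => N x ^- j)).
Proof.
apply: integrable_sphere_continuous => //.
- exact: measurable_esphere.
- exact: sphere_finite.
- exact: sphere_continuous_minkowski_power.
- exact: measurable_minkowski_power.
Qed.

(** This is Hölder's inequality for N^-k and 1. It is obtained from Young's
    inequality at t = 1 / (lam N), where lam^n = vol K / vol B is chosen so that
    there is equality when K is a ball. *)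
Lemma sphere_integral_gauge_power_le :
  \int[sigma]_(x in esphere) w x <=
  n%:R * vol K `^ (k%:R / n%:R) * vol (@eball R n) `^ ((n - k)%:R / n%:R).
Proof.
have vK := vol_star_body_gt0 K_star; have vB := vol_eball_gt0 R n.
have n0' : 0 < n%:R :> R by rewrite ltr0n.
(* lam is the radius of the ball with the volume of K. *)
pose lam := (vol K / vol (@eball R n)) `^ n%:R^-1.
have lam0 : 0 < lam by rewrite powR_gt0// divr_gt0.
have lamn : lam ^+ n = vol K / vol (@eball R n).
  by rewrite -powR_mulrn ?powR_ge0// -powRrM mulVf ?gt_eqF// powRr1// divr_ge0// ltW.
have mS := @measurable_esphere R n.
have young x : esphere x ->
    w x <= lam ^+ k / n%:R * (k%:R * lam ^- n) * N x ^- n + lam ^+ k / n%:R * (n - k)%:R.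
  move=> xS; have := @young_exprn R (lam^-1 * (N x)^-1) k n.
  rewrite k0 kn mulr_ge0 ?invr_ge0 ?(ltW lam0) ?minkowski_ge0// => /(_ erefl erefl).
  rewrite !exprMn !exprVn => h.
  have lk : 0 < lam ^+ k by rewrite exprn_gt0.
  have /(ler_wpM2l (ltW (divr_gt0 lk n0'))) := h.
  rewrite mulrDr => h'; apply: le_trans (le_trans h' _).
    rewrite le_eqVlt; apply/orP; left; apply/eqP.
    by move: (N x ^- k) => a; field; rewrite !gt_eqF.
  by rewrite !mulrA.
have int1 : sigma.-integrable esphere (EFin \o (fun x =>
    lam ^+ k / n%:R * (k%:R * lam ^- n) * N x ^- n)).
  exact: (integrableZl mS _ (integrable_minkowski_power n)).
have int2 (c : R) : sigma.-integrable esphere (EFin \o cst c).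
  apply: integrable_sphere_continuous => //; first exact: sphere_finite.
  by apply: continuous_subspaceT => x; exact: cst_continuous.
apply: le_trans (@le_Rintegral _ _ _ _ _ _ _ mS (integrable_minkowski_power k)
  (integrableD mS int1 (int2 (lam ^+ k / n%:R * (n - k)%:R))) young) _.
rewrite RintegralD// RintegralZl//; last exact: integrable_minkowski_power.
rewrite Rintegral_cst// [X in fine X](surface_measure_sphere R n0)/=.
rewrite {1}/Rintegral sphere_integral_gauge_volume/=.
have -> : (n - k)%:R = n%:R - k%:R :> R by rewrite natrB// ltnW.
have -> : lam ^+ k = vol K `^ (k%:R / n%:R) / vol (@eball R n) `^ (k%:R / n%:R).
  rewrite -powR_mulrn ?powR_ge0// -powRrM [n%:R^-1 * _]mulrC.
  rewrite powRM ?(ltW vK) ?invr_ge0 ?(ltW vB)//; congr (_ * _).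
  by rewrite -(powR_inv1 (ltW vB)) -powRrM mulN1r powRN.
rewrite lamn.
have -> : (n%:R - k%:R) / n%:R = 1 - k%:R / n%:R :> R by rewrite mulrBl divff// gt_eqF.
rewrite powRB ?powRr1 ?(ltW vB)//; last by rewrite (gt_eqF vB) implybT.
have : vol (@eball R n) `^ (k%:R / n%:R) != 0 by rewrite gt_eqF// powR_gt0.
move: (_ `^ _) => b b0.
rewrite le_eqVlt; apply/orP; left; apply/eqP.
by field; rewrite b0 !gt_eqF.
Qed.

End weights.

(** * Central sections as Radon transforms *)

Section moments.
Context (R : realType) (n m : nat) (A : set 'rV[R]_n) (f : 'rV[R]_n -> R).
Hypotheses (A_star : star_body A) (f_cont : continuous f) (f_ge0 : forall x, 0 <= f x).

Lemma integrable_radial_moment (mu : {measure set 'rV[R]_n -> \bar R}) D :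
  measurable D -> (mu D < +oo)%E -> D `<=` esphere ->
  mu.-integrable D (EFin \o radial_moment m A f).
Proof.
move=> mD muD DS; apply: integrable_sphere_continuous => //.
- exact: sphere_continuous_radial_moment.
- exact: measurable_radial_moment.
Qed.

Hypothesis m0 : (0 < m)%N.

(** The right-hand side is radon (radial_moment m A f) H. *)
Lemma density_section_moment (H : grassmannian R n m) :
  density_section f A H =
  \int[surface_measure m (lebesgue_on H)]_(x in esphere `&` carrier H) radial_moment m A f x.
Proof. by rewrite /density_section /Rintegral integral_radial_moment. Qed.

Lemma subspace_sphere_finite (H : grassmannian R n m) :
  (surface_measure m (lebesgue_on H) (esphere `&` carrier H) < +oo)%E.
Proof. by rewrite surface_measure_subspace_sphere// ltry. Qed.

Lemma integrable_cst_subspace_sphere (H : grassmannian R n m) (c : R) :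
  (surface_measure m (lebesgue_on H)).-integrable (esphere `&` carrier H) (EFin \o cst c).
Proof.
apply: integrable_sphere_continuous => //.
- exact: measurable_subspace_sphere.
- exact: subspace_sphere_finite.
- by apply: continuous_subspaceT => x; exact: cst_continuous.
Qed.

(** The moment is bounded on the sphere and the unit spheres of all subspaces H have
    the same area, so the bound is uniform in H. It makes the supremum in the
    theorem an upper bound of the set. *)
Lemma density_section_bounded : exists C : R, forall H : grassmannian R n m,
  0 <= density_section f A H <= C.
Proof.
have [C C0 FC] := sphere_continuous_bounded
  (sphere_continuous_radial_moment (m := m) A_star f_cont f_ge0).
exists (C * (m%:R * vol (@eball R m))) => H; rewrite Rintegral_ge0//=.
have mSH := measurable_subspace_sphere H.
have iA := integrable_radial_moment mSH (subspace_sphere_finite H) (@subIsetl _ _ _).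
have := le_Rintegral mSH iA (integrable_cst_subspace_sphere H C).
rewrite -density_section_moment Rintegral_cst// [X in fine X]surface_measure_subspace_sphere//=.
by apply=> x [xS _]; exact: le_trans (ler_norm _) (FC x xS).
Qed.

End moments.

(** * Comparison of the two measures *)

Lemma fine_sub_le (R : realType) (a b c d : \bar R) :
  a \is a fin_num -> b \is a fin_num -> c \is a fin_num -> d \is a fin_num ->
  (a + d <= b + c)%E -> fine a - fine b <= fine c - fine d.
Proof.
by move: a b c d => [a| |] [b| |] [c| |] [d| |]//= _ _ _ _; rewrite -!EFinD lee_fin; lra.
Qed.

Section comparison.
Context (R : realType) (n k : nat) (f : 'rV[R]_n -> R) (K L : set 'rV[R]_n).
Hypotheses (f_cont : continuous f) (f_ge0 : forall x, 0 <= f x).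
Hypotheses (K_star : star_body K) (L_star : star_body L).
Hypothesis kn : (k < n)%N.

Local Notation N := (minkowski_functional K).
Local Notation sigma := (surface_measure n (rV_lebesgue R n)).
Local Notation w := (fun x => N x ^- k).
Local Notation m := (n - k)%N.

Let n0 : (0 < n)%N. Proof. exact: leq_ltn_trans kn. Qed.
Let m0 : (0 < m)%N. Proof. by rewrite subn_gt0. Qed.

Lemma density_measureE A : density_measure f A = fine (\int[rV_lebesgue R n]_x ((f \_ A) x)%:E)%E.
Proof.
rewrite /density_measure /Rintegral integral_mkcond; congr fine.
by apply: eq_integral => x _; rewrite !patchE; case: ifP.
Qed.

Lemma density_fin_num A : star_body A ->
  (\int[rV_lebesgue R n]_x ((f \_ A) x)%:E)%E \is a fin_num.
Proof.
move=> A_star; have [B B0 fB] := bounded_on_star_body A_star f_cont.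
rewrite ge0_fin_numE; last by apply: integral_ge0 => x _; exact: patch_star_body_ge0.
have mA := measurable_star_body A_star.
apply: (@le_lt_trans _ _ (\int[rV_lebesgue R n]_(x in A) B%:E)%E); last first.
  rewrite integral_cst//; apply: lte_mul_pinfty => //.
  by rewrite -ge0_fin_numE//; exact: star_body_fin_num.
rewrite [leRHS]integral_mkcond; apply: ge0_le_integral => //.
- by move=> x _; exact: patch_star_body_ge0.
- exact: measurable_patch_star_body.
- by apply/(measurable_restrictT _ mA); exact: measurable_cst.
- move=> x _; rewrite !patchE; case: ifPn => //; rewrite inE => Ax.
  by rewrite lee_fin fB.
Qed.

Lemma integrable_weighted_moment A : star_body A ->
  sigma.-integrable esphere (EFin \o (fun x => w x * radial_moment m A f x)).
Proof.
move=> A_star; apply: integrable_sphere_continuous => //.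
- exact: measurable_esphere.
- exact: sphere_finite kn.
- move=> x; have Fx : Filter (nbhs (x : subspace (@esphere R n))) by exact: nbhs_filter.
  apply: (@cvgM _ _ (nbhs (x : subspace (@esphere R n))) Fx).
    exact: sphere_continuous_minkowski_power.
  exact: sphere_continuous_radial_moment.
- apply: measurable_funM; first exact: measurable_minkowski_power.
  exact: measurable_radial_moment.
Qed.

(** As K is the set where N <= 1, the product (1_K - 1_L) (N^-k - 1) is nonnegative
    outside the origin. Integrate it against f and pass to polar coordinates. *)
Lemma weighted_comparison :
  density_measure f K - density_measure f L <=
  \int[sigma]_(x in esphere) (w x * radial_moment m K f x) -
  \int[sigma]_(x in esphere) (w x * radial_moment m L f x).
Proof.
have mS := @measurable_esphere R n.
have fK := density_fin_num K_star; have fL := density_fin_num L_star.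
have aK := integrable_fin_num mS (integrable_weighted_moment K_star).
have aL := integrable_fin_num mS (integrable_weighted_moment L_star).
rewrite !density_measureE; apply: (fine_sub_le fK fL aK aL).
rewrite !integral_weighted_moment//.
have mK := measurable_patch_star_body K_star f_cont.
have mL := measurable_patch_star_body L_star f_cont.
have mw := measurable_minkowski_power K_star k.
have K0 := @patch_star_body_ge0 R n K f f_ge0.
have L0 := @patch_star_body_ge0 R n L f f_ge0.
have mwM (h : 'rV[R]_n -> R) : measurable_fun setT (fun x => (h x)%:E) ->
    measurable_fun setT (fun x => (h x * w x)%:E).
  by move=> mh; apply/measurable_EFinP/measurable_funM => //; exact/measurable_EFinP.
have w0M (h : 'rV[R]_n -> R) : (forall x, 0 <= (h x)%:E)%E -> forall x, (0 <= (h x * w x)%:E)%E.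
  by move=> h0 x; rewrite lee_fin mulr_ge0 ?minkowski_power_ge0// -lee_fin.
have mwK := mwM _ mK; have mwL := mwM _ mL.
have w0K := w0M _ K0; have w0L := w0M _ L0.
rewrite -!ge0_integralD//.
apply: ge0_le_integral => //.
- by move=> x _; rewrite adde_ge0.
- exact: emeasurable_funD.
- exact: emeasurable_funD.
move=> x _; rewrite -!EFinD lee_fin !patchE.
have NE A : star_body A -> (x \in A) = (minkowski_functional A x <= 1).
  by move=> A_star; apply/idP/idP; rewrite inE (minkowski_le1P A_star).
have [KX|KX] := boolP (x \in K); have [LX|LX] := boolP (x \in L); rewrite ?mul0r ?addr0 ?add0r//.
(* At the origin N^-k is 0, since 0^-1 = 0; but the origin lies in both bodies. *)
- have Nx : 0 < N x.
    apply: minkowski_gt0 => //; apply: contraNneq LX => ->.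
    by rewrite inE; case: L_star => _ _ _ /interior_subset.
  rewrite ler_peMr// invf_ge1 ?exprn_gt0// exprn_ile1 ?(ltW Nx)//.
  by rewrite -NE.
- rewrite ler_piMr// invf_le1.
    by rewrite exprn_ege1// ltW// ltNge -NE.
  by rewrite exprn_gt0// (lt_trans ltr01)// ltNge -NE.
Qed.

(** The test function eps / s - F_K + F_L, where s is the area of the unit sphere
    of H, has a nonnegative Radon transform. So nu is nonnegative on the transform,
    which bounds the integral of N^-k (F_K - F_L) from above; weighted_comparison
    bounds it from below. *)
Lemma gauge_comparison (nu : {uniform grassmannian R n m -> R} -> R) (eps : R) :
  positive_functional nu ->
  (forall g, sphere_continuous g -> \int[sigma]_(x in esphere) (w x * g x) = nu (radon g)) ->
  (forall H : grassmannian R n m, density_section f K H - density_section f L H <= eps) ->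
  density_measure f K - density_measure f L <=
  eps / (m%:R * vol (@eball R m)) * \int[sigma]_(x in esphere) w x.
Proof.
move=> [_ _ nu_ge0] nuE Heps.
have mS := @measurable_esphere R n.
have s0 : 0 < m%:R * vol (@eball R m) :> R by rewrite mulr_gt0 ?vol_eball_gt0 ?ltr0n.
set s := m%:R * vol _ in s0 *.
pose g x := eps / s - radial_moment m K f x + radial_moment m L f x.
have cg : sphere_continuous g.
  move=> x; have Fx : Filter (nbhs (x : subspace (@esphere R n))) by exact: nbhs_filter.
  apply: (@cvgD _ _ _ (nbhs (x : subspace (@esphere R n))) Fx).
    apply: (@cvgB _ _ _ (nbhs (x : subspace (@esphere R n))) Fx).
      exact: (@cvg_cst _ _ _ (nbhs (x : subspace (@esphere R n))) Fx).
    exact: sphere_continuous_radial_moment.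
  exact: sphere_continuous_radial_moment.
have radon_g H : 0 <= radon (m := m) g H.
  have mSH := measurable_subspace_sphere H.
  have fSH := subspace_sphere_finite m0 H.
  have iK := integrable_radial_moment m K_star f_cont f_ge0 mSH fSH (@subIsetl _ _ _).
  have iL := integrable_radial_moment m L_star f_cont f_ge0 mSH fSH (@subIsetl _ _ _).
  have ic := integrable_cst_subspace_sphere m0 H (eps / s).
  have iB := integrableB mSH ic iK.
  rewrite /radon /g (RintegralD mSH iB iL) (RintegralB mSH ic iK).
  rewrite -!density_section_moment// Rintegral_cst// [X in fine X]surface_measure_subspace_sphere//=.
  by rewrite divfK ?gt_eqF//; have := Heps H; lra.
have := nu_ge0 (radon g) (ex_intro2 _ _ g cg erefl) radon_g.
rewrite -(nuE _ cg).
have iw := integrable_minkowski_power K_star kn k.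
have iK := integrable_weighted_moment K_star.
have iL := integrable_weighted_moment L_star.
have iew := integrableZl mS (eps / s) iw.
have -> : \int[sigma]_(x in esphere) (w x * g x) =
  \int[sigma]_(x in esphere) (eps / s * w x - w x * radial_moment m K f x
     + w x * radial_moment m L f x).
  by apply: eq_Rintegral => x _; rewrite /g mulrDr mulrBr (mulrC (w x) (eps / s)).
rewrite (RintegralD mS (integrableB mS iew iK) iL) (RintegralB mS iew iK) (RintegralZl _ mS iw).
have aux (a b c d x : R) : 0 <= c * a - b + d -> x <= b - d -> x <= c * a by lra.
by move=> /aux; apply; exact: weighted_comparison.
Qed.

End comparison.

(** One of the two inequalities behind the absolute value; in the other one K
    and L exchange their roles. *)
Lemma density_measure_difference_le (R : realType) (n k : nat) (f : 'rV[R]_n -> R)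
    (K L : set 'rV[R]_n) (eps : R) :
  continuous f -> (forall x, 0 <= f x) ->
  star_body L -> (0 < k < n)%N -> generalized_intersection_body k K -> 0 <= eps ->
  (forall H : grassmannian R n (n - k), density_section f K H - density_section f L H <= eps) ->
  density_measure f K - density_measure f L <=
    n%:R / (n - k)%:R * (vol (@eball R n) `^ ((n - k)%:R / n%:R) / vol (@eball R (n - k))) *
    eps * vol K `^ (k%:R / n%:R).
Proof.
move=> f_cont f_ge0 L_star /andP[k0 kn] [K_star _ [nu nu_pos nuE]] eps0 Heps.
apply: le_trans (gauge_comparison f_cont f_ge0 K_star L_star kn nu_pos nuE Heps) _.
have m0 : 0 < (n - k)%:R :> R by rewrite ltr0n subn_gt0.
have vB := vol_eball_gt0 R (n - k).
have s0 : 0 <= eps / ((n - k)%:R * vol (@eball R (n - k))).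
  by rewrite divr_ge0// mulr_ge0// ltW.
have I := sphere_integral_gauge_power_le K_star k0 kn.
have J := ler_wpM2l s0 I.
apply: (le_trans J).
rewrite le_eqVlt; apply/orP; left; apply/eqP.
by field; rewrite !gt_eqF.
Qed.

Theorem corollary4 (R : realType) (n k : nat) (f : 'rV[R]_n -> R)
    (K L : set 'rV[R]_n)
    (f_even : forall x, f (- x) = f x)
    (f_cont : continuous f)
    (f_ge0 : forall x, 0 <= f x)
    (K_star : star_body K) (K_sym : origin_symmetric K)
    (L_star : star_body L) (L_sym : origin_symmetric L)
    (k_ge1 : (1 <= k)%N) (k_ltn : (k < n)%N)
    (K_gib : generalized_intersection_body k K)
    (L_gib : generalized_intersection_body k L) :
  let c : R := vol (@eball R n) `^ ((n - k)%:R / n%:R) / vol (@eball R (n - k)) in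
  `|density_measure f K - density_measure f L| <=
    n%:R / (n - k)%:R * c *
    sup [set `|density_section f K H - density_section f L H|
        | H in [set: grassmannian R n (n - k)]] *
    Num.max (vol K `^ (k%:R / n%:R)) (vol L `^ (k%:R / n%:R)).
Proof.
cbv zeta; set c := _ / vol (@eball R (n - k)); set S := [set _ | _ in _].
have m0 : (0 < n - k)%N by rewrite subn_gt0.
have k0n : (0 < k < n)%N by rewrite k_ge1.
have [CK HK] := density_section_bounded K_star f_cont f_ge0 m0.
have [CL HL] := density_section_bounded L_star f_cont f_ge0 m0.
have ubS : has_ubound S.
  exists (CK + CL) => _ [H _ <-]; have /andP[K0 KC] := HK H; have /andP[L0 LC] := HL H.
  by rewrite ler_norml; apply/andP; split; lra.
have HS (H : grassmannian R n (n - k)) :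
    `|density_section f K H - density_section f L H| <= sup S.
  by apply: (ub_le_sup ubS); exists H.
have S0 : 0 <= sup S.
  have [[_ [H _ _]]|] := pselect (S !=set0); first exact: le_trans (HS H).
  by move=> /set0P/negP; rewrite negbK => /eqP ->; rewrite sup0.
have coef0 : 0 <= n%:R / (n - k)%:R * c * sup S.
  by rewrite mulr_ge0// mulr_ge0 ?divr_ge0// ?powR_ge0// ltW// vol_eball_gt0.
have KL : density_measure f K - density_measure f L <=
    n%:R / (n - k)%:R * c * sup S * vol K `^ (k%:R / n%:R).
  apply: density_measure_difference_le => // H.
  exact: le_trans (ler_norm _) (HS H).
have LK : density_measure f L - density_measure f K <=
    n%:R / (n - k)%:R * c * sup S * vol L `^ (k%:R / n%:R).
  apply: density_measure_difference_le => // H.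
  by apply: le_trans (ler_norm _) _; rewrite distrC.
rewrite ler_norml lerNl opprB; apply/andP; split.
  by apply: (le_trans LK); rewrite ler_wpM2l// le_max lexx orbT.
by apply: (le_trans KL); rewrite ler_wpM2l// le_max lexx.
Qed.
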